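(* (a) Let $G$ be a line graph and let $t\leq 4$ be a positive integer. Then $G$ has a $K_t$-immersion if and only if $G$ has a $K_t$-minor. (b) For every integer $t\geq 5$ there exists a line graph that has a $K_t$-immersion but no $K_t$-minor, and there exists a line graph that has a $K_t$-minor but no $K_t$-immersion.
   Context: Graphs are finite and may have parallel edges but no loops. A line graph is a graph of the form $L(H)$ for some graph $H$ (possibly with parallel edges), where $L(H)$ is the simple graph with vertex set $E(H)$ in which two distinct edges of $H$ are adjacent iff they share at least one endpoint. A graph $G$ has a $K_t$-immersion if there is an injective map $\phi$ from the vertex set of $K_t$ to $V(G)$ and, for each pair $u\neq v$ of vertices of $K_t$, a path in $G$ joining $\phi(u)$ and $\phi(v)$, such that these paths are pairwise edge-disjoint. $G$ has a $K_t$-minor if $K_t$ can be obtained from a subgraph of $G$ by contracting edges. *)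

(* Defs.v *)
From mathcomp Require Import all_boot.
Set Implicit Arguments. Unset Strict Implicit. Unset Printing Implicit Defensive.

(* Line graph of a loopless multigraph H = (W, E, ends): vertex set E,
   f ~ g iff f <> g and they share at least one endpoint. *)
Definition share_end (W E : finType) (ends : E -> W * W) (f g : E) : bool :=
  [|| (ends f).1 == (ends g).1, (ends f).1 == (ends g).2,
      (ends f).2 == (ends g).1 | (ends f).2 == (ends g).2].

Definition line_rel (W E : finType) (ends : E -> W * W) : rel E :=
  fun f g => (f != g) && share_end ends f g.

Definition is_line_graph (V : finType) (e : rel V) : Prop :=
  exists (W E : finType) (ends : E -> W * W),
    (forall f, (ends f).1 != (ends f).2) /\
    exists h : V -> E, bijective h /\ forall x y, e x y = line_rel ends (h x) (h y).

Definition path_edges (V : finType) (x : V) (p : seq V) : seq {set V} :=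
  [seq [set a.1; a.2] | a <- zip (x :: p) p].

Definition has_Kt_immersion (V : finType) (e : rel V) (t : nat) : Prop :=
  exists phi : 'I_t -> V, injective phi /\
  exists P : 'I_t -> 'I_t -> seq V,
    (forall i j : 'I_t, i < j ->
       [&& path e (phi i) (P i j), uniq (phi i :: P i j) & last (phi i) (P i j) == phi j]) /\
    (forall i j k l : 'I_t, i < j -> k < l -> (i, j) != (k, l) ->
       [disjoint path_edges (phi i) (P i j) & path_edges (phi k) (P k l)]).

Definition induced (V : finType) (e : rel V) (A : {set V}) : rel V :=
  fun a b => [&& a \in A, b \in A & e a b].

Definition has_Kt_minor (V : finType) (e : rel V) (t : nat) : Prop :=
  exists B : 'I_t -> {set V},
    (forall i, B i != set0) /\
    (forall i j, i != j -> [disjoint B i & B j]) /\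
    (forall i, {in B i &, forall x y, connect (induced e (B i)) x y}) /\
    (forall i j, i != j -> exists x y, [/\ x \in B i, y \in B j & e x y]).

(* Main.v *)
Require Import Defs.
From mathcomp Require Import all_boot zify.

Set Implicit Arguments. Unset Strict Implicit. Unset Printing Implicit Defensive.

(**
A [K_t]-minor with [t <= 4] gives a [K_t]-immersion in any graph: a connected branch set has to reach
at most three others, and does so along a tripod, whose centre serves as terminal.

The converse is immediate for [t <= 3]. For [t = 4], let [L(H)] have no [K_4]-minor. Then [H] has
maximum degree at most 3, and three edge-disjoint connections between two vertices of [H] can only be
three parallel edges, since otherwise one of them could be split to give four pairwise touching edge
sets. Any two terminals of a [K_4]-immersion are joined by three edge-disjoint paths. Hence a terminal
[f] is not a bridge of [H], so it lies on a cycle [C]; the components of [H - C] hang on [C] at one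
vertex each and are cut off in [L(H)] by at most two edges, so all four terminals lie on [C]. They cut
[L(H)] into four cyclically arranged parts with at most two edges between consecutive ones, and
[K_4] has no immersion in a doubled 4-cycle.

For [t >= 5], a square with [t - 4] parallel chords and four leaves has [t] inner edges whose line
graph misses two edges of [K_t]; these can be routed through the leaves, but leaves are simplicial of
degree at most [t - 2] and do not help a minor. On the other side, the line graph of a subdivided cubic
graph has maximum degree 3, while it can have arbitrarily large clique minors.
*)

(** * Minors with at most three ports per branch set *)

Section Graph.

Variables (V : finType) (e : rel V).
Hypotheses (esym : symmetric e) (eirr : irreflexive e).

(** Adjacency through a prescribed edge set, an edge being the set of its two ends. Immersions are
    handled as disjoint edge sets with connectivity inside each, so that connections can be
    concatenated freely. *)
Definition via (F : {set {set V}}) : rel V := fun x y => e x y && ([set x; y] \in F).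

Definition inner (B : {set V}) : {set {set V}} := [set E : {set V} | (E \subset B) && (#|E| == 2)].

Lemma connect_cross (r : rel V) (S : {set V}) x y :
  connect r x y -> x \in S -> y \notin S -> exists a b, [/\ a \in S, b \notin S & r a b].
Proof.
case/connectP=> p; elim: p x => [|z p IH] x /=; first by move=> _ -> ->.
case/andP=> rxz pz yl xS yS; have [zS|zS] := boolP (z \in S); last by exists x, z.
exact: IH pz yl zS yS.
Qed.

Lemma via_sym F : symmetric (via F).
Proof. by move=> x y; rewrite /via esym setUC. Qed.

Lemma via_csym F : connect_sym (via F).
Proof. by apply: sym_connect_sym; apply: via_sym. Qed.

Lemma via_sub (F F' : {set {set V}}) : F \subset F' -> subrel (connect (via F)) (connect (via F')).
Proof.
move=> sF; apply: connect_sub => x y /andP[exy xyF]; apply: connect1.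
by rewrite /via exy (subsetP sF).
Qed.

Lemma induced_csym B : connect_sym (induced e B).
Proof.
apply: sym_connect_sym => x y; rewrite /induced esym.
by case: (x \in B); case: (y \in B).
Qed.

Lemma path_via F x p : path (via F) x p = path e x p && all (mem F) (path_edges x p).
Proof.
elim: p x => //= y p IH x; rewrite IH /via /path_edges /=.
by case: (e x y) => //=; case: (path e y p); rewrite /= ?andbF.
Qed.

Lemma pair_mem_lt t (i j k l : 'I_t) : i < j -> k < l ->
  i \in [set k; l] -> j \in [set k; l] -> (i, j) = (k, l).
Proof.
move=> ltij ltkl; rewrite !inE.
by case/orP=> /eqP Ei /orP[] /eqP Ej; subst; rewrite ?ltnn // in ltij *; lia.
Qed.

Lemma pair_eq_lt t (i j k l : 'I_t) : i < j -> k < l -> [set i; j] = [set k; l] -> (i, j) = (k, l).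
Proof. by move=> ltij ltkl E; apply: pair_mem_lt; rewrite // -E ?set21 ?set22. Qed.

(** The given paths matter only for [i < j]; indexing their edge sets by unordered pairs makes the
    family symmetric. An index that is not a pair gets the empty set. *)
Lemma immersion_edge_sets t : has_Kt_immersion e t ->
  exists (phi : 'I_t -> V) (F : {set 'I_t} -> {set {set V}}),
    [/\ injective phi,
        forall i j, i != j -> connect (via (F [set i; j])) (phi i) (phi j) &
        forall A B, A != B -> [disjoint F A & F B]].
Proof.
case=> phi [phi_inj [P [Ppath Pdis]]].
pose sel (A : {set 'I_t}) := [pick ij : 'I_t * 'I_t | (ij.1 < ij.2) && (A == [set ij.1; ij.2])].
have selE (i j : 'I_t) : i < j -> sel [set i; j] = Some (i, j).
  move=> ltij; rewrite /sel; case: pickP => [[k l] /= /andP[ltkl /eqP E]|/(_ (i, j))]; last first.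
    by rewrite ltij eqxx.
  by rewrite (pair_eq_lt ltij ltkl E).
exists phi, (fun A => if sel A is Some ij then
               [set E in path_edges (phi ij.1) (P ij.1 ij.2)] else set0); split=> //.
  move=> i j neij.
  wlog ltij : i j neij / i < j.
    move=> H; have : i != j :> nat by [].
    rewrite neq_ltn => /orP[/(H _ _ neij)//|ltji]; rewrite setUC via_csym.
    by apply: H ltji; rewrite eq_sym.
  rewrite selE //=; case/and3P: (Ppath _ _ ltij) => pP _ /eqP<-.
  apply/connectP; exists (P i j) => //; rewrite path_via pP /=.
  by apply/allP=> E Ep; rewrite /= inE.
move=> A B neAB; rewrite /sel; case: pickP => [[i j] /= /andP[ltij /eqP EA]|_]; last first.
  by rewrite -setI_eq0 set0I.
case: pickP => [[k l] /= /andP[ltkl /eqP EB]|_]; last first.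
  by rewrite -setI_eq0 setI0.
have ne: (i, j) != (k, l) by apply: contraNneq neAB => -[Ei Ej]; rewrite EA EB Ei Ej.
have:= Pdis _ _ _ _ ltij ltkl ne; rewrite !disjoint_subset => /subsetP H.
by apply/subsetP=> E; rewrite !inE => /H; rewrite inE.
Qed.

(** Walks inside disjoint edge sets can be shortened to simple paths without losing disjointness. *)
Lemma edge_sets_immersion t (phi : 'I_t -> V) (F : 'I_t -> 'I_t -> {set {set V}}) :
    injective phi -> (forall i j : 'I_t, i < j -> connect (via (F i j)) (phi i) (phi j)) ->
    (forall (i j k l : 'I_t) E, i < j -> k < l -> E \in F i j -> E \in F k l -> (i, j) = (k, l)) ->
  has_Kt_immersion e t.
Proof.
move=> phi_inj Fcon Fdis.
have /fin_all_exists[P HP] : forall ij : 'I_t * 'I_t, exists p : seq V, ij.1 < ij.2 ->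
    [/\ path (via (F ij.1 ij.2)) (phi ij.1) p, uniq (phi ij.1 :: p) &
        last (phi ij.1) p = phi ij.2].
  case=> i j /=; have [/Fcon|] := boolP (i < j); last by exists [::].
  case/connectP=> p /shortenP[q pq uq _ lq].
  by exists q.
exists phi; split=> //; exists (fun i j => P (i, j)); split=> [i j ltij|i j k l ltij ltkl ne].
  by have [/= + -> ->] := HP (i, j) ltij; rewrite path_via => /andP[-> _] /=.
have [/=] := HP (i, j) ltij; rewrite path_via => /andP[_ /allP pF] _ _.
have [/=] := HP (k, l) ltkl; rewrite path_via => /andP[_ /allP pF'] _ _.
rewrite disjoint_subset; apply/subsetP=> E /pF EF; rewrite inE /=.
by apply: contra ne => /pF' EF'; apply/eqP; apply: (Fdis i j k l E).
Qed.

Lemma card_edge a b : e a b -> #|[set a; b]| = 2.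
Proof. by rewrite cards2; case: eqP => [->|]; rewrite ?eirr. Qed.

Lemma path_inner (S : {set V}) x p :
  path e x p -> {subset x :: p <= S} -> path (via (inner S)) x p.
Proof.
elim: p x => //= y p IH x /andP[exy pp] sub; rewrite IH // => [|z zp].
  rewrite /via exy inE card_edge // eqxx !andbT /=.
  by apply/subsetP=> z; rewrite !inE => /orP[] /eqP->; apply: sub; rewrite !inE eqxx ?orbT.
by apply: sub; rewrite inE zp orbT.
Qed.

(** The path from [z] is followed to its first vertex [c] in [S]; every edge before [c] starts
    outside [S], hence is not in [inner S]. *)
Lemma connect_to_set (B S : {set V}) z x : connect (induced e B) z x -> z \in B -> x \in S ->
  exists c, [/\ c \in S, c \in B & connect (via (inner B :\: inner S)) z c].
Proof.
case/connectP=> p; elim: p z => [|y p IH] z /=; first by move=> _ -> ? ?; exists z.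
case/andP=> /and3P[zB yB ezy] py lx _ xS.
have [zS|zS] := boolP (z \in S); first by exists z.
have [c [cS cB yc]] := IH y py lx yB xS; exists c; split=> //.
apply: connect_trans yc; apply: connect1; rewrite /via ezy !inE card_edge // eqxx !andbT /=.
by rewrite !subUset !sub1set zB yB (negPf zS).
Qed.

(** A path from [z] is stopped at its first vertex [c] on a simple path from [x] to [y]. This path
    and the two halves into which [c] divides the other are the three legs. *)
Lemma tripod (B : {set V}) x y z : {in B &, forall a b, connect (induced e B) a b} ->
  x \in B -> y \in B -> z \in B ->
  exists c F1 F2 F3, [/\ [/\ connect (via F1) c x, connect (via F2) c y & connect (via F3) c z],
    [/\ F1 \subset inner B, F2 \subset inner B & F3 \subset inner B] &
    [/\ [disjoint F1 & F2], [disjoint F1 & F3] & [disjoint F2 & F3]]].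
Proof.
move=> Bcon xB yB zB.
have /connectP[p0 /shortenP[p pp up _] yE] := Bcon _ _ xB yB.
have pB : {subset x :: p <= B}.
  move=> a; rewrite inE => /predU1P[->//|ap].
  elim: p x pp {up yE xB} ap => //= b p IH x /andP[/and3P[_ bB _] pb].
  by rewrite inE => /predU1P[->//|]; apply: IH pb.
have pe : path e x p by apply: sub_path pp => a b /and3P[].
pose S := [set a in x :: p].
have xS : x \in S by rewrite !inE eqxx.
have [c [cS _ zc]] := connect_to_set (Bcon _ _ zB xB) zB xS.
have SB : S \subset B by apply/subsetP=> a; rewrite inE => /pB.
have innerS (A A' : {set V}) : A \subset A' -> inner A \subset inner A'.
  by move=> sA; apply/subsetP=> E; rewrite !inE => /andP[/subset_trans-> //].
rewrite inE in cS; have [p1 [p2 [pE cE]]] : exists p1 p2, p = p1 ++ p2 /\ c = last x p1.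
  by case/splitPl: cS => p1 p2 cE; exists p1, p2.
pose S1 := [set a in x :: p1]; pose S2 := [set a in c :: p2].
have [S1S S2S] : S1 \subset S /\ S2 \subset S.
  split; apply/subsetP=> a; rewrite !inE pE mem_cat; first by case/orP=> ->; rewrite ?orbT.
  case/predU1P=> [->|->]; rewrite ?orbT //.
  have := mem_last x p1; rewrite -cE inE; case/predU1P=> ->; by rewrite ?eqxx ?orbT.
move: pe up; rewrite pE cat_path -cat_cons cat_uniq -cE => /andP[pe1 pe2] /and3P[u1 /hasPn u12 u2].
exists c, (inner S1), (inner S2), (inner B :\: inner S); split.
- split; last by rewrite via_csym.
    rewrite via_csym; apply/connectP; exists p1 => //.
    by apply: path_inner => // a ap; rewrite inE.
  apply/connectP; exists p2; first by apply: path_inner => // a ap; rewrite inE.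
  by rewrite yE pE last_cat -cE.
- by split; [exact/innerS/(subset_trans S1S) | exact/innerS/(subset_trans S2S) | exact: subsetDl].
(* The two halves share only [c], so no two-element set lies inside both. *)
have S12 : S1 :&: S2 \subset [set c].
  apply/subsetP=> a; rewrite !inE => /andP[a1 /predU1P[->//|/u12]].
  by rewrite /= inE a1.
have dis (A : {set V}) : A \subset S -> [disjoint inner A & inner B :\: inner S].
  move=> AS; rewrite disjoint_subset; apply/subsetP=> E /(subsetP (innerS _ _ AS)) ES.
  by rewrite !inE negb_and negbK; move: ES; rewrite inE => ->.
split; [|exact: dis..].
rewrite disjoint_subset; apply/subsetP=> E; rewrite !inE => /andP[E1 E2].
apply: contraTN E2 => /andP[E2 _]; rewrite neq_ltn; apply/orP; left.
have: E \subset [set c] by apply: subset_trans S12; rewrite subsetI E1.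
by move/subset_leq_card; rewrite cards1.
Qed.

Lemma minor_immersion t : t <= 4 -> has_Kt_minor e t -> has_Kt_immersion e t.
Proof.
move=> t4 [B [B0 [Bdis [Bcon Badj]]]].
have Buniq i j x : x \in B i -> x \in B j -> i = j.
  move=> xi xj; apply/eqP; apply: contraT => /Bdis /disjointFr/(_ xi).
  by rewrite xj.
have /fin_all_exists[u Hu] : forall ij : 'I_t * 'I_t, exists u : V * V,
    [/\ u.1 \in B ij.1, u.2 \in B ij.2 & ij.1 != ij.2 -> e u.1 u.2].
  case=> i j /=; have [->|/[dup] neij /Badj[x [y [xi yj exy]]]] := eqVneq i j; last by exists (x, y).
  (* The diagonal needs a value too: with fewer than three other branch sets, the spare ends of the
     tripod are put at [X i i]. *)
  by case/set0Pn: (B0 j) => x xj; exists (x, x).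
(* [X i j] is the port of [B i] towards [B j]; both [X i j] and [X j i] are read off the edge chosen
   for the ordered pair. *)
pose X (i j : 'I_t) := if i <= j then (u (i, j)).1 else (u (j, i)).2.
have XB i j : X i j \in B i.
  by rewrite /X; case: ifP => _; [have [] := Hu (i, j) | have [] := Hu (j, i)].
have Xe (i j : 'I_t) : i < j -> e (X i j) (X j i).
  move=> ltij; rewrite /X ltnW // leqNgt ltij /=; have [_ _ /=] := Hu (i, j).
  by apply; rewrite -val_eqE /= neq_ltn ltij.
have cover3 (i : 'I_t) : exists j1 j2 j3 : 'I_t, forall j, j != i -> [|| j == j1, j == j2 | j == j3].
  clear -t4; pose s := enum (predC1 i).
  have ss : size s <= 3.
    by rewrite /s -cardE cardC1 card_ord; lia.
  exists (nth i s 0), (nth i s 1), (nth i s 2) => j.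
  have -> : (j != i) = (j \in s) by rewrite mem_enum.
  case/(nthP i)=> k /leq_trans/(_ ss) k3 <-.
  by case: k k3 => [|[|[|]]] // _; rewrite eqxx ?orbT.
have /fin_all_exists[cG HcG] : forall i : 'I_t, exists cG : V * {ffun 'I_t -> {set {set V}}},
    [/\ cG.1 \in B i, forall j, j != i -> connect (via (cG.2 j)) cG.1 (X i j),
        forall j, j != i -> cG.2 j \subset inner (B i) &
        forall j k, j != i -> k != i -> j != k -> [disjoint cG.2 j & cG.2 k]].
  move=> i; have [j1 [j2 [j3 Hj]]] := cover3 i.
  have [c [F1 [F2 [F3 [[c1 c2 c3] [s1 s2 s3] [d12 d13 d23]]]]]] :=
    tripod (@Bcon i) (XB i j1) (XB i j2) (XB i j3).
  pose G j := if j == j1 then F1 else if j == j2 then F2 else F3.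
  exists (c, [ffun j => G j]); split=> /=.
  - case/connectP: c1 => [[|a p] /=]; first by move=> _ <-; apply: XB.
    case/andP=> /andP[_ /(subsetP s1)]; rewrite inE => /andP[/subsetP sB _] _ _.
    by apply: sB; rewrite set21.
  - move=> j /Hj; rewrite ffunE /G; case: eqP => [->//|_] /=; case: eqP => [->//|_] /=.
    by move/eqP->.
  - by move=> j _; rewrite ffunE /G; do !case: ifP.
  have GE j : j != i -> [\/ j = j1 /\ G j = F1, j = j2 /\ G j = F2 | j = j3 /\ G j = F3].
    move/Hj; rewrite /G; case: eqP => [->|_] /=; first by constructor 1.
    by case: eqP => [->|_ /eqP->] /=; [constructor 2 | constructor 3].
  move=> j k /GE Gj /GE Gk; rewrite !ffunE.
  case: Gj => -[-> ->]; case: Gk => -[-> ->]; rewrite ?eqxx // => _; by rewrite disjoint_sym.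
pose c i := (cG i).1; pose G i j := (cG i).2 j.
have cB i : c i \in B i by have [] := HcG i.
have Gin i j E x : j != i -> E \in G i j -> x \in E -> x \in B i.
  move=> ne; have [_ _ /(_ _ ne)/subsetP sub _] := HcG i.
  by move=> /sub; rewrite inE => /andP[/subsetP + _]; apply.
have Gne i j E : j != i -> E \in G i j -> exists x, x \in E.
  move=> ne; have [_ _ /(_ _ ne)/subsetP sub _] := HcG i.
  move=> /sub; rewrite inE => /andP[_ /eqP E2]; apply/set0Pn.
  by rewrite -card_gt0 E2.
have Gdis i j k E : j != i -> k != i -> E \in G i j -> E \in G i k -> j = k.
  move=> ji ki Ej Ek; have [_ _ _ H] := HcG i; apply/eqP; apply: contraT => /(H _ _ ji ki).
  by move/disjointFr/(_ Ej); rewrite [_ \in _]Ek.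
(* The connection from [c i] to [c j]: the leg of [i] towards [j], the linking edge, and the leg of
   [j] towards [i]. *)
pose F i j := [set X i j; X j i] |: (G i j :|: G j i).
have neq_lt (i j : 'I_t) : i < j -> (j != i) /\ (i != j).
  by move=> ltij; rewrite -!val_eqE /=; lia.
have FE (i j : 'I_t) E : i < j -> E \in F i j ->
    E = [set X i j; X j i] \/ exists a b, [set a; b] = [set i; j] /\ b != a /\ E \in G a b.
  case/neq_lt=> ji ij; rewrite 3!inE => /or3P[/eqP->|Eij|Eji]; [by left|right..].
    by exists i, j.
  by exists j, i; rewrite setUC.
apply: (@edge_sets_immersion t c F) => [i j cij|i j ltij|i j k l E ltij ltkl EF EF'].
- by apply: (Buniq _ _ (c i)) => //; rewrite cij.
- have [ji ij] := neq_lt _ _ ltij; have [_ /(_ _ ji) Ci _ _] := HcG i.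
  have [_ /(_ _ ij) Cj _ _] := HcG j; rewrite via_csym in Cj.
  apply: connect_trans (via_sub _ Ci) _; first by rewrite /F setUCA subsetUl.
  apply: connect_trans (via_sub _ Cj); last by rewrite /F setUA subsetUr.
  by apply: connect1; rewrite /via Xe // setU11.
(* A linking edge has its ends in two branch sets, while a leg stays within one. *)
have mixed (i' j' k' l' : 'I_t) : i' < j' -> [set X i' j'; X j' i'] \in G k' l' -> l' != k' -> False.
  move=> lt' /[swap] ne' /(Gin _ _ _ _ ne') H.
  have E1 := Buniq _ _ _ (XB i' j') (H _ (set21 _ _)).
  have E2 := Buniq _ _ _ (XB j' i') (H _ (set22 _ _)).
  by rewrite E1 E2 ltnn in lt'.
case: (FE _ _ _ ltkl EF') => [E'|[a' [b' [S' [ba' Eab']]]]];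
  case: (FE _ _ _ ltij EF) => [E1|[a [b [S1 [ba Eab]]]]].
- have X2 i' j' : X i' j' \in E -> i' \in [set k; l].
    rewrite E' !inE => /orP[] /eqP EX.
      by rewrite (Buniq _ _ _ (XB i' j')  (_ : _ \in B k)) ?eqxx // EX.
    by rewrite (Buniq _ _ _ (XB i' j')  (_ : _ \in B l)) ?eqxx ?orbT // EX.
  by apply: pair_mem_lt => //; [apply: (X2 i j) | apply: (X2 j i)]; rewrite E1 ?set21 ?set22.
- by case: (mixed k l a b) => //; rewrite -E'.
- by case: (mixed i j a' b') => //; rewrite -E1.
have [x xE] := Gne _ _ _ ba Eab; apply: pair_eq_lt => //; rewrite -S1 -S'.
have aa' := Buniq _ _ _ (Gin _ _ _ _ ba Eab xE) (Gin _ _ _ _ ba' Eab' xE).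
by subst a'; rewrite (Gdis a b b' E).
Qed.
End Graph.

(** * Small cliques *)

Section Minor.

Variables (V : finType) (e : rel V).
Hypotheses (esym : symmetric e) (eirr : irreflexive e).

Definition connected_set (B : {set V}) := {in B &, forall x y, connect (induced e B) x y}.

Definition touching (A B : {set V}) := exists x y, [/\ x \in A, y \in B & e x y].

Lemma touching_sym A B : touching A B -> touching B A.
Proof. by case=> x [y [xA yB exy]]; exists y, x; rewrite esym. Qed.

Lemma minor_lt t (B : 'I_t -> {set V}) :
  (forall i, B i != set0) -> (forall i, connected_set (B i)) ->
  (forall i j : 'I_t, i < j -> [disjoint B i & B j] /\ touching (B i) (B j)) ->
  has_Kt_minor e t.
Proof.
move=> B0 Bcon H; have H' i j : i != j -> [disjoint B i & B j] /\ touching (B i) (B j).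
  rewrite -val_eqE /= neq_ltn => /orP[/H//|/H[dis /touching_sym]].
  by rewrite disjoint_sym.
by exists B; split=> //; split=> [i j /H'[]|] //; split=> // i j /H'[].
Qed.

Lemma connected_set1 x : connected_set [set x].
Proof. by move=> a b /set1P-> /set1P->. Qed.

Lemma connected_path x p : path e x p -> connected_set [set y in x :: p].
Proof.
move=> pp; have pi : path (induced e [set y in x :: p]) x p.
  have := allss (x :: p); move: {-2}(x :: p) => s.
  elim: p x pp => //= y p IH x /andP[exy py] /and3P[xs ys ps].
  by rewrite /induced !inE xs ys exy /= IH //= ys ps.
have H z : z \in x :: p -> connect (induced e [set y in x :: p]) x z.
  by move=> zp; apply: (path_connect pi).
move=> a b; rewrite !inE => ap bp; apply: connect_trans (H _ bp).
by rewrite (induced_csym esym); apply: H.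
Qed.

Lemma connected_root (B : {set V}) r :
  (forall x, x \in B -> connect (induced e B) r x) -> connected_set B.
Proof.
move=> H x y /H rx /H ry; apply: connect_trans ry.
by rewrite (induced_csym esym).
Qed.

(** The edge [x z] and a path back avoiding it close a cycle; the branch sets are [x], [z] and the
    rest of the cycle. *)
Lemma minor3_cycle x z : e x z ->
  connect (fun a b => e a b && ([set a; b] != [set x; z])) z x -> has_Kt_minor e 3.
Proof.
move=> exz /connectP[p0 /shortenP[p pp up _]]; case/lastP: p pp up => [|q y].
  by move=> _ _ xz; rewrite xz eirr in exz.
rewrite last_rcons => pp up xy; subst y.
(* A return path of a single edge would be the excluded edge itself. *)
case: q pp up => [|a q]; first by rewrite /= setUC eqxx andbF.
rewrite cons_uniq mem_rcons rcons_uniq inE negb_or => + /andP[/andP[zx zq] /andP[xq _]].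
rewrite /= rcons_path => /and3P[/andP[eza _] pa /andP[elx _]].
have pe : path e a q by apply: sub_path pa => b c /andP[].
pose B := [:: [set x]; [set z]; [set y in a :: q]].
apply: (@minor_lt 3 (fun i => nth set0 B i)).
- by case=> [[|[|[|]]]] //= _; apply/set0Pn; [exists x|exists z|exists a]; rewrite !inE eqxx.
- by case=> [[|[|[|]]]] //= _; [apply: connected_set1..|apply: connected_path].
case=> [[|[|[|]]]] // i1 [[|[|[|]]]] //= i2 _; rewrite disjoints1 !inE; split=> //.
- by rewrite eq_sym.
- by exists x, z; rewrite !inE !eqxx.
- by exists x, (last a q); rewrite !inE eqxx -in_cons mem_last esym.
- by exists z, a; rewrite !inE !eqxx.
Qed.

(** The first edge of the path between two terminals lies on a cycle: the rest of that path and the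
    two paths through the third terminal lead back without using it. *)
Lemma immersion_minor3 : has_Kt_immersion e 3 -> has_Kt_minor e 3.
Proof.
case/(immersion_edge_sets esym) => phi [F [phi_inj Fcon Fdis]].
pose i0 : 'I_3 := @Ordinal 3 0 isT; pose i1 : 'I_3 := @Ordinal 3 1 isT.
pose i2 : 'I_3 := @Ordinal 3 2 isT.
have n01 : i0 != i1 by []. have n12 : i1 != i2 by []. have n20 : i2 != i0 by [].
have D12 : [set i0; i1] != [set i1; i2] by apply/eqP=> /setP/(_ i0); rewrite !inE.
have D20 : [set i0; i1] != [set i2; i0] by apply/eqP=> /setP/(_ i1); rewrite !inE.
case/connectP: (Fcon _ _ n01) => p0 /shortenP[[|z p]]; first by move=> _ _ _ /phi_inj.
move=> /= /andP[/andP[exz xzF] pz] /andP[xp _] _ lastp.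
apply: (minor3_cycle exz); set r := (fun _ _ => _).
have off i j : i != j -> [set i0; i1] != [set i; j] -> connect r (phi i) (phi j).
  move=> /Fcon cij /Fdis dis; apply: connect_sub cij => a b /andP[eab abF].
  apply: connect1; rewrite /r eab /=; apply: contraTneq abF => ->.
  by rewrite (disjointFr dis).
apply: connect_trans (connect_trans (off _ _ n12 D12) (off _ _ n20 D20)).
rewrite lastp; apply/connectP; exists p => //.
have sub y q : phi i0 \notin y :: q -> path (via e (F [set i0; i1])) y q -> path r y q.
  elim: q y => //= a q IH y; rewrite !inE !negb_or => /and3P[xy xa xq] /andP[/andP[eya _] pa].
  rewrite IH ?inE ?negb_or ?xa // /r eya !andbT /=.
  by apply: contraTneq (set21 (phi i0) z) => <-; rewrite !inE negb_or xy.
exact: sub.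
Qed.

Lemma immersion_minor2 : has_Kt_immersion e 2 -> has_Kt_minor e 2.
Proof.
case/(immersion_edge_sets esym) => phi [F [phi_inj Fcon Fdis]].
pose i0 : 'I_2 := @Ordinal 2 0 isT; pose i1 : 'I_2 := @Ordinal 2 1 isT.
have n01 : i0 != i1 by [].
case/connectP: (Fcon _ _ n01) => -[|z p]; first by move=> _ /phi_inj.
move=> /= /andP[/andP[exz _] _] _.
apply: (@minor_lt 2 (fun i => nth set0 [:: [set phi i0]; [set z]] i)).
- by case=> [[|[|]]] //= _; apply/set0Pn; [exists (phi i0)|exists z]; rewrite !inE eqxx.
- by case=> [[|[|]]] //= _; apply: connected_set1.
case=> [[|[|]]] // ? [[|[|]]] //= ? _; rewrite disjoints1 !inE; split.
  by apply: contraTneq exz => ->; rewrite eirr.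
by exists (phi i0), z; rewrite !inE !eqxx.
Qed.

Lemma immersion_minor1 : has_Kt_immersion e 1 -> has_Kt_minor e 1.
Proof.
case=> phi _; apply: (@minor_lt 1 (fun _ => [set phi ord0])) => [_|_|i j].
- by apply/set0Pn; exists (phi ord0); rewrite set11.
- exact: connected_set1.
by rewrite !ord1.
Qed.

Lemma minor_clique_seq (s : seq V) : uniq s -> {in s &, forall x y, x != y -> e x y} ->
  has_Kt_minor e (size s).
Proof.
move=> us sc; apply: (@minor_lt _ (fun i => [set tnth (in_tuple s) i])) => [i|i|i j lt].
- by apply/set0Pn; exists (tnth (in_tuple s) i); rewrite set11.
- exact: connected_set1.
have ne : tnth (in_tuple s) i != tnth (in_tuple s) j.
  apply: contraTneq lt => E; rewrite -leqNgt.
  by have /tuple_uniqP/(_ _ _ E)-> : uniq (in_tuple s).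
split; first by rewrite disjoints1 inE.
exists (tnth (in_tuple s) i), (tnth (in_tuple s) j).
by rewrite !set11 sc // mem_tnth.
Qed.

End Minor.

(** * Line graphs and edge cuts *)

Section LineGraph.

Variables (V W : finType) (ends : V -> W * W).
Notation e := (line_rel ends).

Definition inc (w : W) (f : V) := (w == (ends f).1) || (w == (ends f).2).

(** Adjacency in [H] through the edges in [X]. The same set [X] is a vertex set of the line graph,
    where connectivity is that of [induced e X]. *)
Definition adj (X : {set V}) : rel W := fun x y => [exists g in X, inc x g && inc y g].

Lemma lineP f g : reflect (f != g /\ exists w, inc w f /\ inc w g) (e f g).
Proof.
rewrite /line_rel /share_end; apply: (iffP andP) => -[ne H]; split=> //.
  case/or4P: H => /eqP E; [exists (ends f).1 | exists (ends f).1 | exists (ends f).2 | exists (ends f).2];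
    by rewrite /inc !eqxx ?orbT E eqxx ?orbT.
by case: H => w [/orP[] /eqP<- /orP[] /eqP<-]; rewrite !eqxx ?orbT.
Qed.

Lemma line_sym : symmetric e.
Proof.
by move=> f g; apply/lineP/lineP => -[ne [w [wf wg]]]; rewrite eq_sym ne; split=> //; exists w.
Qed.

Lemma line_irr : irreflexive e.
Proof. by move=> f; rewrite /line_rel eqxx. Qed.

Lemma inc2 x y z f : inc x f -> inc y f -> x != y -> inc z f -> z = x \/ z = y.
Proof.
by rewrite /inc => /orP[] /eqP-> /orP[] /eqP->; rewrite ?eqxx // => _ /orP[] /eqP->; auto.
Qed.

Lemma adj_csym X : connect_sym (adj X).
Proof.
apply: sym_connect_sym => x y; apply: eq_existsb => g.
by rewrite andbA andbAC -andbA.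
Qed.

Definition meets (A : {set V}) w := exists2 a, a \in A & inc w a.

Lemma touch A B z : meets A z -> meets B z -> [disjoint A & B] -> touching e A B.
Proof.
case=> a aA za [b bB zb] dis; exists a, b; split=> //; apply/lineP; split; last by exists z.
by apply: contraTneq aA => ->; rewrite (disjointFl dis).
Qed.

Lemma meets_neq0 A z : meets A z -> A != set0.
Proof. by case=> a aA _; apply/set0Pn; exists a. Qed.

Lemma connect_meets X x y : connect (adj X) x y -> x != y -> meets X x.
Proof.
case/connectP=> -[|z p] /=; first by move=> _ ->; rewrite eqxx.
by case/andP=> /exists_inP[g gX /andP[xg _]] _ _ _; exists g.
Qed.

Lemma connect_share (A : {set V}) z g h : g \in A -> h \in A -> inc z g -> inc z h -> connect (induced e A) g h.
Proof.
move=> gA hA zg zh; have [->|ne] := eqVneq g h; first exact: connect0.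
by apply: connect1; rewrite /induced gA hA /=; apply/lineP; split=> //; exists z.
Qed.

(** [A] consists of the edges of [X] in the component of [x]; consecutive edges of a path in [H]
    share a vertex, which makes [A] connected in the line graph. *)
Lemma connected_span X x y : connect (adj X) x y -> x != y ->
  exists A : {set V}, [/\ A \subset X, connected_set e A, meets A x & meets A y].
Proof.
move=> cxy ne; have [g0 g0X xg0] := connect_meets cxy ne.
have [g1 g1X yg1] : meets X y by apply: (@connect_meets _ _ x); rewrite 1?eq_sym // adj_csym.
pose A := [set g in X | [exists z, connect (adj X) x z && inc z g]].
have inA z g : connect (adj X) x z -> inc z g -> g \in X -> g \in A.
  by move=> cz zg gX; rewrite inE gX; apply/existsP; exists z; rewrite cz.
have g0A : g0 \in A by apply: inA xg0 g0X.
exists A; split; first by apply/subsetP=> g; rewrite inE => /andP[].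
- apply: (connected_root line_sym (r := g0)) => g; rewrite inE => /andP[gX /existsP[z /andP[cz zg]]].
  case/connectP: cz gX zg => p; elim/last_ind: p z g => [|p b IH] z g.
    by move=> _ -> gX xg; apply: (connect_share _ _ xg0 xg) => //; apply: inA xg gX.
  rewrite rcons_path last_rcons => /andP[pp /exists_inP[h hX /andP[lh bh]]] -> gX bg.
  have cl : connect (adj X) x (last x p) by apply/connectP; exists p.
  have cb : connect (adj X) x b.
    by apply: connect_trans cl _; apply: connect1; apply/exists_inP; exists h; rewrite ?lh.
  apply: connect_trans (IH _ h pp erefl hX lh) _.
  by apply: (connect_share _ _ bh bg); [apply: inA bh hX | apply: inA bg gX].
- by exists g0.
by exists g1 => //; apply: inA yg1 g1X.
Qed.

(** A simple path with more than one edge splits into its first edge, which becomes [A], and a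
    remainder whose component becomes [B]. *)
Lemma connected_split X x y : connect (adj X) x y -> x != y ->
  (exists2 g, g \in X & inc x g && inc y g) \/
  exists A B : {set V}, [/\ A \subset X, B \subset X, [disjoint A & B] &
    [/\ connected_set e A, connected_set e B, meets A x, meets B y & touching e A B]].
Proof.
move=> cxy ne; case/connectP: cxy => p0 /shortenP[[|z p] pp up _ yl]; first by rewrite yl eqxx in ne.
move: pp up => /= /andP[/exists_inP[g gX /andP[xg zg]] pz] /andP[xp up].
have [E|zy] := eqVneq z y; first by left; exists g => //; rewrite xg -E.
(* The remaining path avoids [x], so it cannot use the edge [g] again. *)
right; have sub a q : uniq (a :: q) -> x \notin a :: q -> path (adj X) a q -> path (adj (X :\ g)) a q.
  elim: q a => // b q IH a /andP[aq uq]; rewrite inE negb_or => /andP[xa xq] /= /andP[ab pb].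
  rewrite IH // andbT; case/exists_inP: ab => h hX /andP[ah bh].
  apply/exists_inP; exists h; last by rewrite ah.
  rewrite !inE hX andbT; apply: contraNneq aq => E; subst h.
  by case: (inc2 xg ah xa bh) => [E|->]; rewrite inE ?eqxx //; move: xq; rewrite inE E eqxx.
have cz : connect (adj (X :\ g)) z y by rewrite yl; apply/connectP; exists p => //; apply: sub.
have [B [BX Bcon Bz By]] := connected_span cz zy.
have gB : [disjoint [set g] & B].
  by rewrite disjoints1; apply/negP=> /(subsetP BX); rewrite !inE eqxx.
have gm w : inc w g -> meets [set g] w by exists g; rewrite ?set11.
exists [set g], B; split; rewrite ?sub1set //; first exact: subset_trans BX (subsetDl _ _).
split=> //; [exact: connected_set1 | exact: gm | exact: touch (gm _ zg) Bz gB].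
Qed.

Lemma minor4 (A0 A1 A2 A3 : {set V}) :
    [/\ A0 != set0, A1 != set0, A2 != set0 & A3 != set0] ->
    [/\ connected_set e A0, connected_set e A1, connected_set e A2 & connected_set e A3] ->
    [/\ [disjoint A0 & A1], [disjoint A0 & A2] & [disjoint A0 & A3]] ->
    [/\ [disjoint A1 & A2], [disjoint A1 & A3] & [disjoint A2 & A3]] ->
    [/\ touching e A0 A1, touching e A0 A2 & touching e A0 A3] ->
    [/\ touching e A1 A2, touching e A1 A3 & touching e A2 A3] ->
  has_Kt_minor e 4.
Proof.
move=> [? ? ? ?] [? ? ? ?] [? ? ?] [? ? ?] [? ? ?] [? ? ?].
apply: (@minor_lt _ _ line_sym 4 (fun i => nth set0 [:: A0; A1; A2; A3] i)).
- by case=> [[|[|[|[|]]]]].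
- by case=> [[|[|[|[|]]]]].
by case=> [[|[|[|[|]]]]] // ? [[|[|[|[|]]]]].
Qed.

(** If [X1] has no single edge from [x] to [y], its connection splits in two. These two parts and
    the connections in [X2] and [X3] touch pairwise, at [x], at [y] or at the splitting point, and
    form a [K_4]-minor. *)
Lemma theta_parallel (X1 X2 X3 : {set V}) x y : ~ has_Kt_minor e 4 -> x != y ->
    [/\ [disjoint X1 & X2], [disjoint X1 & X3] & [disjoint X2 & X3]] ->
    connect (adj X1) x y -> connect (adj X2) x y -> connect (adj X3) x y ->
  exists2 g, g \in X1 & inc x g && inc y g.
Proof.
move=> noK4 ne [d12 d13 d23] c1 c2 c3; case: (connected_split c1 ne) => // -[A [B [AX BX dAB]]].
case=> Ac Bc Ax By tAB; case: noK4.
have [A2 [s2 c2' A2x A2y]] := connected_span c2 ne.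
have [A3 [s3 c3' A3x A3y]] := connected_span c3 ne.
have dA2 : [disjoint A & A2] by apply: disjointWl AX (disjointWr s2 d12).
have dA3 : [disjoint A & A3] by apply: disjointWl AX (disjointWr s3 d13).
have dB2 : [disjoint B & A2] by apply: disjointWl BX (disjointWr s2 d12).
have dB3 : [disjoint B & A3] by apply: disjointWl BX (disjointWr s3 d13).
have d23' : [disjoint A2 & A3] by apply: disjointWl s2 (disjointWr s3 d23).
apply: (@minor4 A B A2 A3); split=> //.
- exact: meets_neq0 Ax.
- exact: meets_neq0 By.
- exact: meets_neq0 A2x.
- exact: meets_neq0 A3x.
- exact: touch Ax A2x dA2.
- exact: touch Ax A3x dA3.
- exact: touch By A2y dB2.
- exact: touch By A3y dB3.
- exact: touch A2x A3x d23'.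
Qed.

Definition star w := [set g | inc w g].

(** The edges at one vertex of [H] form a clique of the line graph. *)
Lemma star_le3 w : ~ has_Kt_minor e 4 -> #|star w| <= 3.
Proof.
move=> noK4; rewrite leqNgt; apply/negP=> gt3; apply: noK4.
have -> : 4 = size (take 4 (enum (star w))) by rewrite size_takel // -cardE.
apply: minor_clique_seq; [exact: line_sym | by rewrite take_uniq // enum_uniq |].
move=> f g /mem_take + /mem_take; rewrite !mem_enum !inE => wf wg ne.
by apply/lineP; split=> //; exists w.
Qed.

(** The edges of the line graph that leave [f] through its end [w]. *)
Definition fan f w := [set [set f; y] | y in star w :\ f].

Lemma fan_le2 f w : ~ has_Kt_minor e 4 -> inc w f -> #|fan f w| <= 2.
Proof.
move=> noK4 wf; apply: leq_trans (leq_imset_card _ _) _.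
by have := star_le3 w noK4; rewrite (cardsD1 f) inE wf.
Qed.

Lemma mem_fan f w y : inc w y -> y != f -> [set f; y] \in fan f w.
Proof. by move=> wy yf; apply: imset_f; rewrite !inE yf. Qed.

End LineGraph.

Lemma pair_neq (T : finType) (a b x : T) (A : {set T}) : x \in [set a; b] -> x \notin A -> [set a; b] != A.
Proof. by move=> xab; apply: contraNneq => <-. Qed.

Ltac neq := first [assumption | rewrite eq_sym; assumption].

Ltac pair_neq := solve
  [ apply: (pair_neq (set21 _ _)); rewrite !inE negb_or; apply/andP; split; neq
  | apply: (pair_neq (set22 _ _)); rewrite !inE negb_or; apply/andP; split; neq ].

(** * Small edge cuts between terminals of a [K_4]-immersion *)

Section Terminals.

Variables (V : finType) (e : rel V) (phi : 'I_4 -> V) (F : {set 'I_4} -> {set {set V}}).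
Hypotheses (phi_inj : injective phi)
  (Fcon : forall i j, i != j -> connect (via e (F [set i; j])) (phi i) (phi j))
  (Fdis : forall A B, A != B -> [disjoint F A & F B]).

Definition hit A (D : {set {set V}}) := ~~ [disjoint F A & D].

Lemma hitP A (D : {set {set V}}) : reflect (exists2 E, E \in F A & E \in D) (hit A D).
Proof.
apply: (iffP idP) => [|[E EF ED]].
  by rewrite /hit -setI_eq0 => /set0Pn[E /setIP[? ?]]; exists E.
by apply/negP=> /disjointFr/(_ EF); rewrite ED.
Qed.

(** Disjoint edge sets spend different edges of [D]. *)
Lemma three_hits (D : {set {set V}}) A B C : #|D| <= 2 -> A != B -> A != C -> B != C ->
  hit A D -> hit B D -> hit C D -> False.
Proof.
move=> D2 AB AC BC /hitP[E1 EA D1] /hitP[E2 EB D2'] /hitP[E3 EC D3].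
have ne A' B' E E' : A' != B' -> E \in F A' -> E' \in F B' -> E != E'.
  by move=> /Fdis dis EA' EB'; apply: contraTneq EA' => ->; rewrite (disjointFl dis).
have: #|[set E1; E2; E3]| <= #|D|.
  by apply/subset_leq_card/subsetP=> E; rewrite !inE => /orP[/orP[]|] /eqP->.
rewrite -setUA cardsU1 cards2 !inE (ne _ _ _ _ BC) // negb_or (ne _ _ _ _ AB) // (ne _ _ _ _ AC) //.
by lia.
Qed.

Lemma hit_cross (S : {set V}) (D : {set {set V}}) i j : phi i \in S -> phi j \notin S ->
  (forall a b, a \in S -> b \notin S -> e a b -> [set a; b] \in D) -> hit [set i; j] D.
Proof.
move=> iS jS H; have ne : i != j by apply: contraTneq iS => ->.
have [a [b [aS bS /andP[eab abF]]]] := connect_cross (Fcon ne) iS jS.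
by apply/hitP; exists [set a; b] => //; apply: H.
Qed.

(** Three edge-disjoint routes lead from terminal [i] to terminal [j]: the direct one and one
    through each of the other terminals [k] and [l]. Each has to cross the cut. *)
Lemma cut_ge3 (S : {set V}) (D : {set {set V}}) i j : phi i \in S -> phi j \notin S ->
  (forall a b, a \in S -> b \notin S -> e a b -> [set a; b] \in D) -> 2 < #|D|.
Proof.
move=> iS jS H; rewrite ltnNge; apply/negP=> D2.
have ne : i != j by apply: contraTneq iS => ->.
have : #|~: [set i; j]| == 2 by rewrite cardsCs setCK cards2 ne card_ord.
case/cards2P=> k [l [kl E]].
have [ki kj] : k != i /\ k != j by have := set21 k l; rewrite -E !inE negb_or => /andP.
have [li lj] : l != i /\ l != j by have := set22 k l; rewrite -E !inE negb_or => /andP.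
have h0 := hit_cross iS jS H.
have hk : hit [set i; k] D || hit [set k; j] D.
  have [kS|kS] := boolP (phi k \in S); first by rewrite (hit_cross kS jS H) orbT.
  by rewrite (hit_cross iS kS H).
have hl : hit [set i; l] D || hit [set l; j] D.
  have [lS|lS] := boolP (phi l \in S); first by rewrite (hit_cross lS jS H) orbT.
  by rewrite (hit_cross iS lS H).
by case/orP: hk => hk; case/orP: hl => hl; apply: (three_hits D2 _ _ _ h0 hk hl); pair_neq.
Qed.

End Terminals.

(** * Terminals on a cycle *)

Section Cycle.

Variables (V W : finType) (ends : V -> W * W).
Notation e := (line_rel ends).
Hypothesis noK4 : ~ has_Kt_minor e 4.

Variables (phi : 'I_4 -> V) (F : {set 'I_4} -> {set {set V}}).
Hypotheses (phi_inj : injective phi)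
  (Fcon : forall i j, i != j -> connect (via e (F [set i; j])) (phi i) (phi j))
  (Fdis : forall A B, A != B -> [disjoint F A & F B]).

(** The vertices [w 0, ..., w m] form a cycle of [H], with [c i] the edge from [w i] to [w (nx i)];
    the closing edge [c m] is a terminal. For [m = 1] the cycle is a pair of parallel edges. *)
Variables (m : nat) (w : nat -> W) (c : nat -> V).
Let nx i := if i == m then 0 else i.+1.
Hypotheses (m_gt0 : 0 < m)
  (w_inj : forall i j, i <= m -> j <= m -> w i = w j -> i = j)
  (c_inj : forall i j, i <= m -> j <= m -> c i = c j -> i = j)
  (inc_w : forall i, i <= m -> inc ends (w i) (c i))
  (inc_nx : forall i, i <= m -> inc ends (w (nx i)) (c i))
  (phi0 : phi ord0 = c m).

Let C := [set c k | k : 'I_m.+1].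

Lemma nx_le i : i <= m -> nx i <= m.
Proof. by rewrite /nx; case: eqP; lia. Qed.

Lemma nx_lt i : i < m -> nx i = i.+1.
Proof. by move=> im; rewrite /nx ltn_eqF. Qed.

Lemma mem_C i : i <= m -> c i \in C.
Proof. by rewrite -ltnS => lt; apply/imsetP; exists (Ordinal lt). Qed.

Lemma C_ex g : g \in C -> exists2 i, i <= m & g = c i.
Proof. by case/imsetP=> k _ ->; exists k => //; have := ltn_ord k. Qed.

Lemma inc_cycle i z : i <= m -> inc ends z (c i) -> z = w i \/ z = w (nx i).
Proof.
move=> im; apply: inc2; [exact: inc_w | exact: inc_nx |].
by apply/eqP=> /w_inj; rewrite im nx_le // => /(_ isT isT); rewrite /nx; case: eqP; lia.
Qed.

Lemma connect_arc X a b : a <= b ->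
  (forall k, a <= k < b -> adj ends X (w k) (w k.+1)) -> connect (adj ends X) (w a) (w b).
Proof.
elim: b => [|b IH]; first by case: a.
rewrite leq_eqVlt ltnS => /orP[/eqP<-//|ab] H.
apply: connect_trans (IH ab _) (connect1 (H _ _)); last by rewrite ab /=.
by move=> k /andP[ak kb]; apply: H; lia.
Qed.

(* With the two arcs of the cycle, a third connection between two of its vertices is a theta;
   it then consists of three parallel edges, which form a whole component of the line graph. *)
Lemma no_chord i j : i < j -> j <= m -> ~~ connect (adj ends (~: C)) (w i) (w j).
Proof.
move=> ij jm; apply/negP=> c3; have im : i <= m by lia.
(* The two arcs of the cycle between [w i] and [w j]; the second contains the closing edge [c m]. *)
pose X1 := [set c k | k : 'I_m.+1 & i <= k < j].
pose X2 := [set c k | k : 'I_m.+1 & (k < i) || (j <= k)].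
have cX (P : pred nat) k : k <= m -> P k -> c k \in [set c k | k : 'I_m.+1 & P k].
  by rewrite -ltnS => lt Pk; apply/imsetP; exists (Ordinal lt); rewrite ?inE.
have ne : w i != w j by apply/eqP=> /w_inj; rewrite im jm => /(_ isT isT); lia.
have c1 : connect (adj ends X1) (w i) (w j).
  apply: connect_arc; first lia; move=> k H; have km : k <= m by lia.
  apply/exists_inP; exists (c k); first exact: (cX (fun k => i <= k < j)).
  by rewrite inc_w //=; have := inc_nx km; rewrite /nx ifN //; lia.
have c2 : connect (adj ends X2) (w i) (w j).
  have arc k : k < m -> (k < i) || (j <= k) -> adj ends X2 (w k) (w k.+1).
    move=> km H; apply/exists_inP; exists (c k); first by apply: (cX (fun k => (k < i) || (j <= k))) => //; lia.
    by have := inc_nx (ltnW km); rewrite (inc_w (ltnW km)) /= /nx ifN //; lia.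
  rewrite adj_csym; apply: (connect_trans (y := w m)).
    by apply: connect_arc => // k H; apply: arc; lia.
  apply: (connect_trans (y := w 0)).
    apply: connect1; apply/exists_inP; exists (c m).
      by apply: (cX (fun k => (k < i) || (j <= k))) => //; rewrite jm orbT.
    by have := inc_nx (leqnn m); rewrite inc_w //= /nx eqxx.
  by apply: connect_arc => // k H; apply: arc; lia.
have d12 : [disjoint X1 & X2].
  rewrite -setI_eq0; apply/eqP/setP=> g; rewrite !inE; apply/negP=> /andP[/imsetP[k]].
  rewrite inE => Hk -> /imsetP[l]; rewrite inE => Hl /c_inj.
  have := ltn_ord k; have := ltn_ord l; rewrite !ltnS => -> -> /(_ isT isT); lia.
have dC (X : {set V}) : X \subset C -> [disjoint X & ~: C] by rewrite disjoints_subset setCK.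
have d13 : [disjoint X1 & ~: C] by apply/dC/subsetP=> g /imsetP[k _ ->]; apply: imset_f.
have d23 : [disjoint X2 & ~: C] by apply/dC/subsetP=> g /imsetP[k _ ->]; apply: imset_f.
have [g1 g1X /andP[ig1 jg1]] := theta_parallel noK4 ne (And3 d12 d13 d23) c1 c2 c3.
have d21 : [disjoint X2 & X1] by rewrite disjoint_sym.
have [g2 g2X /andP[ig2 jg2]] := theta_parallel noK4 ne (And3 d21 d23 d13) c2 c1 c3.
have d31 : [disjoint ~: C & X1] by rewrite disjoint_sym.
have d32 : [disjoint ~: C & X2] by rewrite disjoint_sym.
have [g3 g3X /andP[ig3 jg3]] := theta_parallel noK4 ne (And3 d31 d32 d12) c3 c1 c2.
pose S := [set g1; g2; g3].
have S3 : #|S| = 3.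
  rewrite /S -setUA cardsU1 cards2 !inE negb_or.
  have -> : g1 != g2 by apply: contraTneq g1X => ->; rewrite (disjointFl d12).
  have -> : g1 != g3 by apply: contraTneq g1X => ->; rewrite (disjointFl d13).
  by have -> : g2 != g3 by apply: contraTneq g2X => ->; rewrite (disjointFl d23).
(* Since no vertex has more than three edges, the three parallel edges are all the edges at both of
   their ends. *)
have starS z : z = w i \/ z = w j -> S = star ends z.
  move=> Hz; apply/eqP; rewrite eqEcard S3 star_le3 // andbT.
  by apply/subsetP=> g; rewrite !inE => /orP[/orP[]|] /eqP->; case: Hz => ->.
have Sclosed a b : a \in S -> e a b -> b \in S.
  move=> aS /lineP[_ [z [za zb]]]; rewrite (starS z) ?inE //.
  by move: aS za; rewrite !inE => /orP[/orP[]|] /eqP->; apply: inc2.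
(* Walking along the cycle from [g1] stays in [S], so the terminal [c m] is in [S]; then all four
   terminals would be among three edges. *)
have cmS : c m \in S.
  have [k km g1E] : exists2 k, k <= m & g1 = c k.
    by case/imsetP: g1X => k _ ->; exists k; rewrite // -ltnS.
  have step n : k <= n -> n <= m -> c n \in S.
    elim: n => [|n IH]; first by rewrite leqn0 => /eqP<- _; rewrite -g1E !inE eqxx.
    rewrite leq_eqVlt => /orP[/eqP<- _|]; first by rewrite -g1E !inE eqxx.
    rewrite ltnS => kn nm; apply: Sclosed (IH kn (ltnW nm)) _; apply/lineP; split.
      by apply/eqP=> /(c_inj (ltnW nm) nm)/n_Sn.
    exists (w n.+1); split; last exact: inc_w.
    by rewrite -nx_lt // inc_nx // ltnW.
  exact: step.
have phiS l : phi l \in S.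
  apply: contraT => lS; have ne0 : ord0 != l by apply: contraNneq lS => <-; rewrite phi0.
  have [|a [b [aS bS /andP[/(Sclosed _ _ aS)]]]] := connect_cross (Fcon ne0) _ lS.
    by rewrite phi0.
  by rewrite (negPf bS).
have : #|phi @: setT| <= #|S| by apply/subset_leq_card/subsetP=> _ /imsetP[l _ ->].
by rewrite card_imset // cardsT card_ord S3.
Qed.

(** By [no_chord], a component of [H] without the edges of [C] contains at most one vertex of the
    cycle and takes its index. A component with no such vertex gets the default [m]. *)
Lemma vertex_index : exists iota : W -> nat,
  [/\ forall z, iota z <= m, forall i, i <= m -> iota (w i) = i &
      forall g x y, g \notin C -> inc ends x g -> inc ends y g -> iota x = iota y].
Proof.
pose r := adj ends (~: C).
pose iota z := if [pick k : 'I_m.+1 | connect r (w k) z] is Some k then val k else m.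
exists iota; split=> [z|i im|g x y gC xg yg].
- by rewrite /iota; case: pickP => // k _; apply: (leq_ord k).
- rewrite /iota; case: pickP => [k ck|/(_ (Ordinal (im : i < m.+1)))]; last by rewrite connect0.
  have km : k <= m by rewrite -ltnS.
  case: (ltngtP (val k) i) => // lt; first by have /negP[] := no_chord lt im.
  by have /negP[] := no_chord lt km; rewrite adj_csym.
rewrite /iota; congr (if _ is Some k then val k else m); apply: eq_pick => k.
apply: same_connect_r; first exact: adj_csym.
by apply: connect1; apply/exists_inP; exists g; rewrite ?inE ?xg.
Qed.

(** Positions pass to edges: [c i] has position [i], and an edge off the cycle has that of its
    component. If it meets a cycle edge, it does so at the one cycle vertex of that component. *)
Lemma edge_index : exists rho : V -> nat,
  [/\ forall g, rho g <= m, forall i, i <= m -> rho (c i) = i,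
      forall z f g, f \notin C -> g \notin C -> inc ends z f -> inc ends z g -> rho f = rho g &
      forall z f i, f \notin C -> i <= m -> inc ends z f -> inc ends z (c i) -> z = w (rho f)].
Proof.
have [iota [iota_le iota_w iota_g]] := vertex_index.
pose rho g := if [pick k : 'I_m.+1 | c k == g] is Some k then val k else iota (ends g).1.
have inc1 g : inc ends (ends g).1 g by rewrite /inc eqxx.
have rhoN g z : g \notin C -> inc ends z g -> rho g = iota z.
  move=> gC zg; rewrite /rho; case: pickP => [k /eqP kg|_]; last exact: iota_g gC (inc1 g) zg.
  by rewrite -kg mem_C // -ltnS in gC.
exists rho; split=> [g|i im|z f g fC gC zf zg|z g i gC im zg zc].
- by rewrite /rho; case: pickP => // k _; apply: (leq_ord k).
- rewrite /rho; case: pickP => [k /eqP /c_inj|/(_ (Ordinal (im : i < m.+1)))]; last by rewrite eqxx.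
  by apply; rewrite // -ltnS.
- by rewrite (rhoN f z) // (rhoN g z).
rewrite (rhoN g z) //; case: (inc_cycle im zc) => ->; rewrite iota_w ?nx_le //.
Qed.

Section Index.

Variable rho : V -> nat.
Hypotheses (rho_le : forall g, rho g <= m) (rho_c : forall i, i <= m -> rho (c i) = i)
  (rhoNN : forall z f g, f \notin C -> g \notin C -> inc ends z f -> inc ends z g -> rho f = rho g)
  (rhoNC : forall z f i, f \notin C -> i <= m -> inc ends z f -> inc ends z (c i) -> z = w (rho f)).

(** Positions change only at a vertex [w (nx i)], between [c i] and edges of position [nx i]. The
    second alternative is the wrap from [m] to [0]. *)
Lemma edge_jump x y : e x y -> rho x < rho y ->
    [/\ x = c (rho x), rho y = (rho x).+1 & inc ends (w (rho y)) y] \/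
    [/\ y = c m, rho y = m, rho x = 0 & inc ends (w 0) x].
Proof.
move=> /lineP[ne [z [zx zy]]] lt.
have [/C_ex[i im xE]|xC] := boolP (x \in C); have [/C_ex[j jm yE]|yC] := boolP (y \in C).
- subst x y; rewrite !rho_c // in lt *.
  have zi := inc_cycle im zx; have zj := inc_cycle jm zy.
  have ww a b : a <= m -> b <= m -> z = w a -> z = w b -> a = b.
    by move=> am bm -> /w_inj; apply.
  have im' := nx_le im; have jm' := nx_le jm; move: (im') (jm'); rewrite /nx.
  have nxi : nx i = i.+1 by rewrite /nx ifN //; lia.
  case: zi => zi; case: zj => zj.
  + by move: (ww _ _ im jm zi zj); lia.
  + have := ww _ _ im jm' zi zj; rewrite /nx; case: eqP => [-> i0|]; last by lia.
    by move=> _ _; right; split; rewrite ?rho_c // -i0 // inc_w.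
  + have := ww _ _ im' jm zi zj; rewrite nxi => <-; move=> _ _; left; split=> //.
    by rewrite -nxi -zi zi nxi inc_w //; lia.
  have := ww _ _ im' jm' zi zj; rewrite nxi /nx; case: eqP; lia.
- subst x; rewrite rho_c // in lt *; have zE := rhoNC yC im zy zx; left; split=> //.
    case: (inc_cycle im zx) => E; rewrite E in zE.
      by move/w_inj: zE => /(_ im (rho_le y)); lia.
    move/w_inj: zE => /(_ (nx_le im) (rho_le y)) <-; rewrite /nx ifN //.
    by have := rho_le y; lia.
  by rewrite -zE.
- subst y; rewrite rho_c // in lt *; have zE := rhoNC xC jm zx zy; right.
  case: (inc_cycle jm zy) => E; rewrite E in zE.
    by move/w_inj: zE => /(_ jm (rho_le x)); lia.
  move/w_inj: zE => /(_ (nx_le jm) (rho_le x)); rewrite /nx; case: eqP => [jE x0|]; last by lia.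
  by subst j; rewrite -x0; split=> //; move: zx; rewrite E /nx eqxx.
by rewrite (rhoNN xC yC zx zy) ltnn in lt.
Qed.

(** The off-cycle edges of one position are cut off by the pairs of an off-cycle and a cycle edge at
    a single vertex of [H]. Two numbers with sum at most 3 have product at most 2, so the cut is too
    small. *)
Lemma terminals_on_cycle l : phi l \in C.
Proof.
apply: contraT => lC; set i := rho (phi l).
pose S := [set g | (g \notin C) && (rho g == i)].
pose N := star ends (w i).
pose D := [set [set p.1; p.2] | p in setX (N :\: C) (N :&: C)].
have lS : phi l \in S by rewrite inE lC /i eqxx.
have mS : phi ord0 \notin S by rewrite phi0 inE mem_C.
suff H a b : a \in S -> b \notin S -> e a b -> [set a; b] \in D.
  have := cut_ge3 Fcon Fdis lS mS H; rewrite ltnNge => /negP[].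
  apply: leq_trans (leq_imset_card _ _) _; rewrite cardsX.
  by have := star_le3 (w i) noK4; rewrite -(cardsID C) -/N; nia.
rewrite !inE => /andP[aC /eqP ai] bS /lineP[ne [z [za zb]]].
have [bC|bC] := boolP (b \in C); last by rewrite bC -ai (rhoNN aC bC za zb) eqxx in bS.
have [k km bE] := C_ex bC; rewrite bE in zb.
have zE := rhoNC aC km za zb; rewrite ai in zE.
by apply/imsetP; exists (a, b) => //; rewrite !inE aC bC bE -zE za zb.
Qed.

(** The edges of the line graph by which [c k] passes from position [k] to position [nx k]. *)
Let jump k := fan ends (c k) (w (nx k)).

(** An interval of positions after [i] up to [j] can be left only backwards through the jump at [i]
    or forwards through the jump at [j]. *)
Lemma arc_hit i j s t : i < j <= m -> i < rho (phi s) <= j -> ~~ (i < rho (phi t) <= j) ->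
  hit F [set s; t] (jump i) || hit F [set s; t] (jump j).
Proof.
move=> /andP[ij jm] sij tij; pose S := [set x | i < rho x <= j].
have sS : phi s \in S by rewrite inE.
have tS : phi t \notin S by rewrite inE.
suff H a b : a \in S -> b \notin S -> e a b -> [set a; b] \in jump i :|: jump j.
  have /hitP[E EF] := hit_cross Fcon sS tS H.
  by rewrite inE => /orP[] ED; apply/orP; [left|right]; apply/hitP; exists E.
rewrite !inE => aS bS eab; have ne : a != b by case/lineP: eab.
have [lt|gt|E] := ltngtP (rho a) (rho b); last by rewrite -E aS in bS.
  have [[aE bE wb]|[_ _ a0 _]] := edge_jump eab lt; last by lia.
  have jE : rho a = j by lia.
  have jm' : j < m by have := rho_le b; lia.
  rewrite jE in aE; rewrite bE jE in wb; apply/orP; right; rewrite aE.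
  by apply: mem_fan; [rewrite nx_lt | rewrite eq_sym -aE].
rewrite (line_sym ends) in eab.
have [[bE aE wa]|[aE am b0 wb]] := edge_jump eab gt.
  have iE : rho b = i by lia.
  rewrite iE in bE; rewrite aE iE in wa; apply/orP; left; rewrite setUC bE.
  by apply: mem_fan; [rewrite nx_lt //; lia | rewrite -bE].
have jE : j = m by lia.
by apply/orP; right; rewrite aE jE; apply: mem_fan; rewrite /nx ?eqxx // -aE eq_sym.
Qed.

Lemma jump_le2 k : k <= m -> #|jump k| <= 2.
Proof. by move=> km; apply: fan_le2 => //; apply: inc_nx. Qed.

(* Each diagonal pair uses the jumps of two consecutive arcs, each side pair its own jump or the
   three others; some jump is then used three times, although it has only two edges. *)
Lemma no_ordered_terminals x0 x1 x2 x3 :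
  rho (phi x0) < rho (phi x1) -> rho (phi x1) < rho (phi x2) -> rho (phi x2) < rho (phi x3) ->
  rho (phi x3) = m -> False.
Proof.
set r0 := rho (phi x0); set r1 := rho (phi x1); set r2 := rho (phi x2).
move=> l01 l12; set r3 := rho (phi x3) => l23 r3m.
have nr x y : rho (phi x) < rho (phi y) -> x != y by apply: contraTneq => ->; rewrite ltnn.
have n01 : x0 != x1 by apply: nr.
have n12 : x1 != x2 by apply: nr.
have n23 : x2 != x3 by apply: nr.
have n02 : x0 != x2 by apply: nr; apply: ltn_trans l12.
have n13 : x1 != x3 by apply: nr; apply: ltn_trans l23.
have n03 : x0 != x3 by apply: nr; apply: ltn_trans (ltn_trans l01 l12) l23.
(* The jumps at [r0], [r1], [r2] and [r3 = m] cut the positions into four cyclic arcs, each with one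
   terminal, at its last position. *)
pose H s t k := hit F [set s; t] (jump k).
have arc s t i j : i < j <= r3 -> i < rho (phi s) <= j -> ~~ (i < rho (phi t) <= j) ->
    H s t i \/ H s t j.
  by rewrite r3m => ? ? ?; apply/orP; apply: arc_hit.
have arcC s t i j : i < j <= r3 -> i < rho (phi s) <= j -> ~~ (i < rho (phi t) <= j) ->
    H t s i \/ H t s j.
  by rewrite /H setUC; apply: arc.
have [d02 d02'] : (H x0 x2 r0 \/ H x0 x2 r2) /\ (H x0 x2 r0 \/ H x0 x2 r3).
  by split; apply: arcC; rewrite -/r0 -/r2; clear -l01 l12 l23; lia.
have [e02 e02'] : (H x0 x2 r1 \/ H x0 x2 r2) /\ (H x0 x2 r1 \/ H x0 x2 r3).
  by split; apply: arcC; rewrite -/r0 -/r2; clear -l01 l12 l23; lia.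
have [d13 d13'] : (H x1 x3 r0 \/ H x1 x3 r1) /\ (H x1 x3 r0 \/ H x1 x3 r2).
  by split; apply: arc; rewrite -/r1 -/r3; clear -l01 l12 l23; lia.
have [e13 e13'] : (H x1 x3 r1 \/ H x1 x3 r3) /\ (H x1 x3 r2 \/ H x1 x3 r3).
  by split; apply: arcC; rewrite -/r1 -/r3; clear -l01 l12 l23; lia.
have s01 k : k \in [:: r1; r2; r3] -> H x0 x1 r0 \/ H x0 x1 k.
  by rewrite !inE => /or3P[] /eqP->; apply: arcC; rewrite -/r0 -/r1; clear -l01 l12 l23; lia.
have s12 k : k \in [:: r0; r2; r3] -> H x1 x2 r1 \/ H x1 x2 k.
  rewrite !inE => /or3P[] /eqP->;
    first (by apply/or_comm; apply: arc; rewrite -/r1 -/r2; clear -l01 l12 l23; lia);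
    by apply: arcC; rewrite -/r1 -/r2; clear -l01 l12 l23; lia.
have s23 k : k \in [:: r0; r1; r3] -> H x2 x3 r2 \/ H x2 x3 k.
  rewrite !inE => /or3P[] /eqP->; last by apply: arcC; rewrite -/r2 -/r3; clear -l01 l12 l23; lia.
    by apply/or_comm; apply: arc; rewrite -/r2 -/r3; clear -l01 l12 l23; lia.
  by apply/or_comm; apply: arc; rewrite -/r2 -/r3; clear -l01 l12 l23; lia.
have s03 k : k \in [:: r0; r1; r2] -> H x0 x3 r3 \/ H x0 x3 k.
  by rewrite !inE => /or3P[] /eqP->; apply/or_comm; apply: arcC; rewrite -/r0 -/r3; clear -l01 l12 l23; lia.
have T k s t s' t' s'' t'' : k <= r3 -> [set s; t] != [set s'; t'] -> [set s; t] != [set s''; t''] ->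
    [set s'; t'] != [set s''; t''] -> H s t k -> H s' t' k -> H s'' t'' k -> False.
  by rewrite r3m => km; apply: three_hits => //; apply: jump_le2.
have [r0' r1' r2'] : [/\ r0 <= r3, r1 <= r3 & r2 <= r3] by clear -l01 l12 l23; split; lia.
(* One way round from [x0] to [x2] passes the jumps at [r0] and [r1], the other those at [r2] and
   [r3]. *)
have D02 : (H x0 x2 r0 /\ H x0 x2 r1) \/ (H x0 x2 r2 /\ H x0 x2 r3) by clear -d02 d02' e02 e02'; tauto.
have D13 : (H x1 x3 r1 /\ H x1 x3 r2) \/ (H x1 x3 r3 /\ H x1 x3 r0) by clear -d13 d13' e13 e13'; tauto.
(* The diagonals have a jump in common, which is then full. The side pair of this jump must go the
   long way round and fills a second jump; the side pair of that one is then blocked both ways. *)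
case: D02 => -[h02 h02']; case: D13 => -[h13 h13'].
- case: (s12 r0) => [|h|h]; first by rewrite inE eqxx.
    by apply: (T r1 _ _ _ _ _ _ r1' _ _ _ h02' h13 h); pair_neq.
  case: (s01 r1) => [|k|k]; first by rewrite inE eqxx.
    by apply: (T r0 _ _ _ _ _ _ r0' _ _ _ h02 h k); pair_neq.
  by apply: (T r1 _ _ _ _ _ _ r1' _ _ _ h02' h13 k); pair_neq.
- case: (s01 r1) => [|h|h]; first by rewrite inE eqxx.
    by apply: (T r0 _ _ _ _ _ _ r0' _ _ _ h02 h13' h); pair_neq.
  case: (s12 r0) => [|k|k]; first by rewrite inE eqxx.
    by apply: (T r1 _ _ _ _ _ _ r1' _ _ _ h02' h k); pair_neq.
  by apply: (T r0 _ _ _ _ _ _ r0' _ _ _ h02 h13' k); pair_neq.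
- case: (s23 r3) => [|h|h]; first by rewrite !inE eqxx !orbT.
    by apply: (T r2 _ _ _ _ _ _ r2' _ _ _ h02 h13' h); pair_neq.
  case: (s03 r2) => [|k|k]; first by rewrite !inE eqxx !orbT.
    by apply: (T r3 _ _ _ _ _ _ (leqnn _) _ _ _ h02' h k); pair_neq.
  by apply: (T r2 _ _ _ _ _ _ r2' _ _ _ h02 h13' k); pair_neq.
case: (s03 r2) => [|h|h]; first by rewrite !inE eqxx !orbT.
  by apply: (T r3 _ _ _ _ _ _ (leqnn _) _ _ _ h02' h13 h); pair_neq.
case: (s23 r3) => [|k|k]; first by rewrite !inE eqxx !orbT.
  by apply: (T r2 _ _ _ _ _ _ r2' _ _ _ h02 h k); pair_neq.
by apply: (T r3 _ _ _ _ _ _ (leqnn _) _ _ _ h02' h13 k); pair_neq.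
Qed.

(** The terminals sit on the cycle at distinct positions, [phi ord0] at the last one; it remains to
    sort the other three. *)
Lemma no_indexed_terminals : False.
Proof.
have phiE l : phi l = c (rho (phi l)).
  by have [k km E] := C_ex (terminals_on_cycle l); rewrite E rho_c.
have r_inj k l : rho (phi k) = rho (phi l) -> k = l.
  by move=> E; apply: phi_inj; rewrite phiE E -phiE.
have r0m : rho (phi ord0) = m by rewrite phi0 rho_c.
have lt_m l : l != ord0 -> rho (phi l) < rho (phi ord0).
  by move=> l0; rewrite ltn_neqAle r0m rho_le andbT -r0m; apply: contraNneq l0 => /r_inj->.
pose i1 : 'I_4 := @Ordinal 4 1 isT; pose i2 : 'I_4 := @Ordinal 4 2 isT.
pose i3 : 'I_4 := @Ordinal 4 3 isT.
have [l1 l2 l3] : [/\ rho (phi i1) < rho (phi ord0), rho (phi i2) < rho (phi ord0) &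
  rho (phi i3) < rho (phi ord0)] by split; apply: lt_m.
have nr k l : k != l -> rho (phi k) != rho (phi l) by apply: contraNneq => /r_inj->.
have ord x y z : rho (phi x) < rho (phi y) -> rho (phi y) < rho (phi z) ->
  rho (phi z) < rho (phi ord0) -> False.
  by move=> xy yz /(no_ordered_terminals xy yz); apply.
have n12 : rho (phi i1) != rho (phi i2) by apply: nr.
have n13 : rho (phi i1) != rho (phi i3) by apply: nr.
have n23 : rho (phi i2) != rho (phi i3) by apply: nr.
case: (ltngtP (rho (phi i1)) (rho (phi i2))) n12 => // lt12 _;
  case: (ltngtP (rho (phi i1)) (rho (phi i3))) n13 => // lt13 _;
  case: (ltngtP (rho (phi i2)) (rho (phi i3))) n23 => // lt23 _.
- exact: ord lt12 lt23 l3.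
- exact: ord lt13 lt23 l2.
- by have := ltn_trans lt12 (ltn_trans lt23 lt13); rewrite ltnn.
- exact: ord lt13 lt12 l2.
- exact: ord lt12 lt13 l3.
- by have := ltn_trans lt12 (ltn_trans lt13 lt23); rewrite ltnn.
- exact: ord lt23 lt13 l1.
- exact: ord lt23 lt12 l1.
Qed.

End Index.

Lemma no_cycle_terminal : False.
Proof.
have [rho [rho_le rho_c rhoNN rhoNC]] := edge_index.
exact: no_indexed_terminals rho_le rho_c rhoNN rhoNC.
Qed.

End Cycle.

(** Families of branch sets form a finite type, so the case distinction on a [K_4]-minor requires no
    classical axiom. *)
Lemma minor_dec (V : finType) (e : rel V) t : has_Kt_minor e t \/ ~ has_Kt_minor e t.
Proof.
pose model (B : {ffun 'I_t -> {set V}}) := [&& [forall i, B i != set0],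
  [forall i, forall j, (i != j) ==> [disjoint B i & B j]],
  [forall i, forall x in B i, forall y in B i, connect (induced e (B i)) x y] &
  [forall i, forall j, (i != j) ==> [exists x in B i, exists y in B j, e x y]]].
suff : reflect (has_Kt_minor e t) [exists B, model B] by case; [left|right].
apply: (iffP existsP) => [[B /and4P[/forallP B0 /forallP Bd /forallP Bc /forallP Ba]]|].
  exists B; split=> //; split; first by move=> i j; apply/implyP; move/forallP: (Bd i); apply.
  split=> [i x y xi yi|i j ij].
    by have /forall_inP/(_ x xi)/forall_inP/(_ y yi) := Bc i.
  by have /forallP/(_ j)/implyP/(_ ij)/exists_inP[x xi /exists_inP[y yj exy]] := Ba i; exists x, y.
case=> B [B0 [Bd [Bc Ba]]]; exists [ffun i => B i]; apply/and4P; split.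
- by apply/forallP=> i; rewrite ffunE.
- by apply/forallP=> i; apply/forallP=> j; apply/implyP; rewrite !ffunE; apply: Bd.
- apply/forallP=> i; rewrite ffunE; apply/forall_inP=> x xi; apply/forall_inP=> y yi.
  exact: Bc.
apply/forallP=> i; apply/forallP=> j; apply/implyP=> /Ba[x [y [xi yj exy]]]; rewrite !ffunE.
by apply/exists_inP; exists x => //; apply/exists_inP; exists y.
Qed.

(** * Finding the cycle through a terminal *)

Section LineGraph4.

Variables (V W : finType) (ends : V -> W * W).
Hypothesis ends_neq : forall f, (ends f).1 != (ends f).2.
Notation e := (line_rel ends).

(* If removing the edge [f] disconnects its two ends, then in the line graph [f] is separated from
   every other vertex by the at most two edges leaving [f] at one of its ends. *)
Lemma terminal_on_cycle (phi : 'I_4 -> V) (F : {set 'I_4} -> {set {set V}}) :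
    ~ has_Kt_minor e 4 -> injective phi ->
    (forall i j, i != j -> connect (via e (F [set i; j])) (phi i) (phi j)) ->
    (forall A B, A != B -> [disjoint F A & F B]) ->
  connect (adj ends [set~ phi ord0]) (ends (phi ord0)).2 (ends (phi ord0)).1.
Proof.
move=> noK4 phi_inj Fcon Fdis; set f := phi ord0; set u := (ends f).1; set v := (ends f).2.
rewrite adj_csym; apply: contraT => nuv; pose r := adj ends [set~ f].
have incf z : inc ends z f -> z = u \/ z = v by rewrite /inc => /orP[] /eqP->; auto.
have [fu fv] : inc ends u f /\ inc ends v f by rewrite /inc !eqxx orbT.
pose A := [set g | (g != f) && connect r u (ends g).1].
have inA g z : g != f -> inc ends z g -> (g \in A) = connect r u z.
  move=> gf zg; rewrite inE gf /=; apply: same_connect_r; first exact: adj_csym.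
  by apply: connect1; apply/exists_inP; exists g; rewrite ?inE //= zg /inc eqxx.
have l0 : phi ord_max != f by rewrite (inj_eq phi_inj).
have fA : f \notin A by rewrite inE eqxx.
(* [A] is the side of [u] without [f]. A terminal in [A] is cut off from [f] by the fan at [u]; a
   terminal outside is cut off by the fan at [v]. *)
have [lA|lA] := boolP (phi ord_max \in A).
  suff H a b : a \in A -> b \notin A -> e a b -> [set a; b] \in fan ends f u.
    by have := cut_ge3 Fcon Fdis lA fA H; rewrite ltnNge (fan_le2 noK4 fu).
  move=> aA bA /lineP[ne [z [za zb]]].
  have af : a != f by apply: contraNneq fA => <-.
  have [bf|bf] := eqVneq b f; last by rewrite (inA _ z) // -(inA a) ?aA in bA.
  subst b; rewrite setUC; case: (incf _ zb) => E; subst z; first exact: mem_fan.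
  by rewrite (inA _ _ af za) (negPf nuv) in aA.
have fS : f \in f |: A by rewrite setU11.
have lS : phi ord_max \notin f |: A by rewrite in_setU1 negb_or l0 lA.
suff H a b : a \in f |: A -> b \notin f |: A -> e a b -> [set a; b] \in fan ends f v.
  by have := cut_ge3 Fcon Fdis fS lS H; rewrite ltnNge (fan_le2 noK4 fv).
rewrite !in_setU1 negb_or => aS /andP[bf bA] /lineP[ne [z [za zb]]].
have [af|af] := eqVneq a f; last first.
  by rewrite (negPf af) /= (inA _ _ af za) -(inA _ _ bf zb) (negPf bA) in aS.
subst a; case: (incf _ za) => E; subst z; last exact: mem_fan.
by rewrite (inA _ _ bf zb) connect0 in bA.
Qed.

(** A path of [H] from [v] to [u] that avoids the terminal [f] has the vertices [w 0, ..., w m];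
    adding [f] as last edge [c m] closes it to the cycle on which the terminals are ruled out. *)
Lemma immersion_minor4 : has_Kt_immersion e 4 -> has_Kt_minor e 4.
Proof.
case/(immersion_edge_sets (line_sym ends)) => phi [F [phi_inj Fcon Fdis]].
case: (minor_dec e 4) => // noK4; exfalso.
have := terminal_on_cycle noK4 phi_inj Fcon Fdis.
set f := phi ord0; set u := (ends f).1; set v := (ends f).2.
case/connectP=> p0 /shortenP[p pp up _ uE].
pose m := size p; pose w i := nth v (v :: p) i.
have [fu fv] : inc ends u f /\ inc ends v f by rewrite /inc !eqxx orbT.
have wm : w m = u by rewrite /w nth_last uE.
have m0 : 0 < m by rewrite lt0n; apply: contraNneq (ends_neq f) => m0; rewrite -/u -/v -wm m0.
have w_inj i j : i <= m -> j <= m -> w i = w j -> i = j.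
  by move=> im jm /eqP; rewrite nth_uniq // => /eqP.
(* Parallel edges leave a choice of [c i]. For [i < m] the path supplies an edge other than [f], so
   the default of [odflt] is not taken. *)
pose c i := if i < m then odflt f [pick g | (g != f) && (inc ends (w i) g && inc ends (w i.+1) g)] else f.
have cP i : i < m -> [/\ c i != f, inc ends (w i) (c i) & inc ends (w i.+1) (c i)].
  move=> im; rewrite /c im; case: pickP => [g /and3P[]//|/= H].
  have /exists_inP[g gf /andP[wg wg']] := pathP v pp i im.
  by have := H g; rewrite -in_setC1 gf wg [inc _ _ _]wg'.
have cm : c m = f by rewrite /c ltnn.
have c_lt i j : i < j -> j <= m -> c i != c j.
  move=> ij; rewrite leq_eqVlt => /orP[/eqP jm|jm].
    by rewrite jm cm; case: (cP i) => //; rewrite -jm.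
  have im : i < m by apply: ltn_trans jm.
  have [_ wi wi'] := cP _ im; have [_ wj wj'] := cP _ jm; apply/eqP=> E.
  have ne : w j != w j.+1 by apply/eqP=> /(w_inj _ _ (ltnW jm) jm)/n_Sn.
  have im' : i <= m by apply: ltnW.
  by rewrite E in wi; case: (inc2 wj wj' ne wi) => /w_inj; lia.
apply: (@no_cycle_terminal _ _ _ noK4 _ _ phi_inj Fcon Fdis m w c) => //.
- move=> i j im jm E; case: (ltngtP i j) => // lt; [have := c_lt _ _ lt jm | have := c_lt _ _ lt im];
    by rewrite E eqxx.
- by move=> i; rewrite leq_eqVlt => /orP[/eqP->|/cP[]//]; rewrite cm wm.
move=> i; rewrite leq_eqVlt => /orP[/eqP->|im]; first by rewrite eqxx cm.
by rewrite (ltn_eqF im); case: (cP i im).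
Qed.

End LineGraph4.

(** * Degrees and simplicial vertices *)

Section Degree.

Variables (V : finType) (e : rel V).
Hypotheses (esym : symmetric e) (eirr : irreflexive e).

Definition nbrs v := [set a | e v a].

(** The [t] connections from one terminal leave it by distinct edges. *)
Lemma immersion_degree t : has_Kt_immersion e t.+1 -> exists v, t <= #|nbrs v|.
Proof.
case/(immersion_edge_sets esym) => phi [F [phi_inj Fcon Fdis]]; exists (phi ord0).
have /fin_all_exists[b Hb] : forall i : 'I_t.+1, exists b, ord0 != i ->
    e (phi ord0) b /\ [set phi ord0; b] \in F [set ord0; i].
  move=> i; have [<-|ne] := eqVneq ord0 i; first by exists (phi ord0).
  have [||a [b [/set1P-> _ /andP[]]]] := connect_cross (S := [set phi ord0]) (Fcon _ _ ne).
  - exact: set11.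
  - by rewrite inE (inj_eq phi_inj) eq_sym.
  by exists b.
have binj : {in [set~ ord0] &, injective b}.
  move=> i j; rewrite !inE !(eq_sym _ ord0) => i0 j0 E.
  have [_ Ei] := Hb i i0; have [_ Ej] := Hb j j0; rewrite E in Ei.
  have ES : [set ord0; i] = [set ord0; j].
    by apply/eqP; apply: contraT => /Fdis/disjointFr/(_ Ei); rewrite Ej.
  have : i \in [set ord0; j] by rewrite -ES set22.
  by rewrite !inE eq_sym (negPf i0) => /eqP.
apply: (@leq_trans #|b @: [set~ ord0]|); first by rewrite card_in_imset // cardsC1 card_ord.
apply/subset_leq_card/subsetP=> _ /imsetP[i i0 ->]; rewrite !inE eq_sym in i0 *.
by have [] := Hb i i0.
Qed.

(** The branch sets are a parameter here, so that vertices can be deleted from them one after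
    another. *)
Definition minor_model t (B : 'I_t -> {set V}) :=
  (forall i, B i != set0) /\
  (forall i j, i != j -> [disjoint B i & B j]) /\
  (forall i, connected_set e (B i)) /\
  (forall i j, i != j -> touching e (B i) (B j)).

(** The neighbours of [v] are pairwise adjacent, so paths can bypass [v] and its contacts pass to a
    neighbour in the same branch set. *)
Lemma delete_simplicial t (B : 'I_t.+1 -> {set V}) v :
    (forall a b, e v a -> e v b -> a != b -> e a b) -> #|nbrs v| < t -> minor_model B ->
  minor_model (fun i => B i :\ v).
Proof.
move=> simp deg [B0 [Bdis [Bcon Badj]]].
have Buniq i j x : x \in B i -> x \in B j -> i = j.
  by move=> xi xj; apply/eqP; apply: contraT => /Bdis /disjointFr/(_ xi); rewrite xj.
(* A branch set consisting of [v] alone would need a neighbour of [v] in each of the [t] others. *)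
have ne0 i : B i :\ v != set0.
  apply/negP=> /eqP Bv; have Bi x : x \in B i -> x = v.
    by move=> xi; apply/eqP; apply: contraT => xv; have := in_set0 x; rewrite -Bv !inE xv xi.
  have /fin_all_exists[b Hb] : forall j : 'I_t.+1, exists b, i != j -> b \in B j /\ e v b.
    move=> j; have [<-|/Badj[x [y [/Bi-> yj vy]]]] := eqVneq i j; first by exists v.
    by exists y.
  have binj : {in [set~ i] &, injective b}.
    move=> j k; rewrite !inE !(eq_sym _ i) => ij ik E.
    have [bj _] := Hb j ij; have [bk _] := Hb k ik; rewrite E in bj; exact: Buniq bj bk.
  move: deg; rewrite ltnNge => /negP[].
  apply: (@leq_trans #|b @: [set~ i]|); first by rewrite card_in_imset // cardsC1 card_ord.
  apply/subset_leq_card/subsetP=> _ /imsetP[j j0 ->]; rewrite !inE eq_sym in j0 *.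
  by have [] := Hb j j0.
(* The vertex [a] is where the new path stands: at [x], or at a neighbour of [v] while the old path
   is at [v]. *)
have path_around (A : {set V}) p x a : path (induced e A) x p -> last x p != v -> a \in A :\ v ->
    a = x \/ x = v /\ e v a -> connect (induced e (A :\ v)) a (last x p).
  elim: p x a => [|z p IH] x a /=; first by move=> _ xv _ [->//|[E]]; rewrite E eqxx in xv.
  case/andP=> /and3P[xA zA exz] pz lv aA H.
  have step b c : b \in A :\ v -> c \in A :\ v -> e b c -> connect (induced e (A :\ v)) b c.
    by move=> bA cA ebc; apply: connect1; rewrite /induced bA cA.
  have [zv|zv] := eqVneq z v.
    apply: IH => //; right; split=> //.
    by case: H => [->|[xv]]; [rewrite -zv esym | rewrite zv xv eirr in exz].
  have zAv : z \in A :\ v by rewrite !inE zv.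
  apply: connect_trans (IH z z pz lv zAv (or_introl erefl)).
  case: H => [aE|[xv va]]; first by apply: step => //; rewrite aE.
  have [->|az] := eqVneq a z; first exact: connect0.
  apply: step => //; apply: simp => //.
  by rewrite -xv.
have nbr_v i j y : i != j -> v \in B i -> y \in B j -> e v y -> exists u, u \in B i :\ v /\ e u y.
  move=> ij vi yj vy; case/set0Pn: (ne0 i) => b /setD1P[bv bi].
  case/connectP: (Bcon i _ _ vi bi) => -[|u p] /=; first by move=> _ E; rewrite E eqxx in bv.
  case/andP=> /and3P[_ ui vu] _ _; exists u; split.
    by rewrite !inE ui andbT; apply: contraTneq vu => ->; rewrite eirr.
  apply: simp => //; apply: contraNneq ij => E; subst u.
  by rewrite (Buniq _ _ _ ui yj).
split=> //; split.
  by move=> i j /Bdis dis; apply: disjointWl (subsetDl _ _) (disjointWr (subsetDl _ _) dis).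
split.
  move=> i x y xB yB; case/setD1P: (xB) => xv xi; case/setD1P: (yB) => yv yi.
  case/connectP: (Bcon i _ _ xi yi) => p pp yE; rewrite yE.
  by apply: (path_around _ _ x) => //; [rewrite -yE | left].
move=> i j ij; have [x [y [xi yj exy]]] := Badj i j ij.
have [xv|xv] := eqVneq x v.
  subst x; have [u [uB euy]] := nbr_v _ _ _ ij xi yj exy; exists u, y; split=> //.
  by rewrite !inE yj andbT; apply: contraTneq exy => ->; rewrite eirr.
have [yv|yv] := eqVneq y v; last by exists x, y; rewrite !inE xv yv.
subst y; rewrite eq_sym in ij; rewrite esym in exy.
have [u [uB eux]] := nbr_v _ _ _ ij yj xi exy; exists x, u; split=> //; last by rewrite esym.
by rewrite !inE xv.
Qed.

End Degree.

(** * Separating examples *)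

Lemma line_is_line (V W : finType) (ends : V -> W * W) :
  (forall f, (ends f).1 != (ends f).2) -> is_line_graph (line_rel ends).
Proof. by move=> ne; exists W, V, ends; split=> //; exists id; split=> //; exists id. Qed.

(** * A line graph with an immersion but no minor *)

Section Chorded4Cycle.

Variable n : nat.
Notation t := n.+4.+1.

Definition pt k (lt : k < 8) : 'I_8 := Ordinal lt.
Definition rim k (lt : k < t) : 'I_t + 'I_4 := inl (Ordinal lt).
Definition leaf k (lt : k < 4) : 'I_t + 'I_4 := inr (Ordinal lt).

(* The square 0123 with [t - 4] parallel chords 02; two leaves at 1 and one leaf at each of 2, 0. *)
Definition square_ends (f : 'I_t + 'I_4) : 'I_8 * 'I_8 :=
  match f with
  | inl k => match val k with
    | 0 => (@pt 0 isT, @pt 1 isT) | 1 => (@pt 1 isT, @pt 2 isT)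
    | 2 => (@pt 2 isT, @pt 3 isT) | 3 => (@pt 3 isT, @pt 0 isT)
    | _ => (@pt 0 isT, @pt 2 isT)
    end
  | inr k => match val k with
    | 0 => (@pt 1 isT, @pt 4 isT) | 1 => (@pt 1 isT, @pt 5 isT)
    | 2 => (@pt 2 isT, @pt 6 isT) | _ => (@pt 0 isT, @pt 7 isT)
    end
  end.

Notation e := (line_rel square_ends).

Lemma square_loopless f : (square_ends f).1 != (square_ends f).2.
Proof. by case: f => [[[|[|[|[|k]]]]]|[[|[|[|[|k]]]]]]. Qed.

(** Only opposite sides of the square are not adjacent. Each of these two pairs gets a detour
    through two leaves of its own, every edge of which contains a leaf. *)
Definition square_path (i j : 'I_t) : seq ('I_t + 'I_4) :=
  match val i, val j with
  | 0, 2 => [:: @leaf 0 isT; @rim 1 isT; @leaf 2 isT; inl j]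
  | 1, 3 => [:: @leaf 1 isT; @rim 0 isT; @leaf 3 isT; inl j]
  | _, _ => [:: inl j]
  end.

Lemma square_path_ok (i j : 'I_t) : i < j ->
  path e (inl i) (square_path i j) /\ last (inl i) (square_path i j) = inl j.
Proof.
have inlE (a b : 'I_t) : ((inl a : 'I_t + 'I_4) == inl b) = (a == b) by [].
case: i j => [[|[|[|[|i]]]] Hi] [[|[|[|[|j]]]] Hj] //= lt; split=> //;
  by rewrite /line_rel inlE -val_eqE /= ?andbT // ltn_eqF.
Qed.

(** The marks tell the two detours apart, and both from the direct edges. *)
Definition leaf_mark (E : {set 'I_t + 'I_4}) : bool * bool :=
  ((@leaf 0 isT \in E) || (@leaf 2 isT \in E), (@leaf 1 isT \in E) || (@leaf 3 isT \in E)).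

Lemma square_path_mark (i j : 'I_t) E : i < j -> E \in path_edges (inl i) (square_path i j) ->
  [\/ leaf_mark E = (false, false) /\ E = [set inl i; inl j],
      leaf_mark E = (true, false) /\ (i = 0 :> nat /\ j = 2 :> nat) |
      leaf_mark E = (false, true) /\ (i = 1 :> nat /\ j = 3 :> nat)].
Proof.
move=> lt; have gen : E \in [:: [set inl i; inl j]] ->
    leaf_mark E = (false, false) /\ E = [set inl i; inl j].
  by rewrite inE => /eqP->; rewrite /leaf_mark !inE.
rewrite /square_path.
case Ei: (val i) => [|[|?]]; case Ej: (val j) => [|[|[|[|?]]]];
  try (by move=> /gen; constructor 1).
- rewrite /path_edges /= !inE => /or4P[] /eqP->; constructor 2; split=> //; by rewrite /leaf_mark !inE.
rewrite /path_edges /= !inE => /or4P[] /eqP->; constructor 3; split=> //; by rewrite /leaf_mark !inE.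
Qed.

Lemma square_immersion : has_Kt_immersion e t.
Proof.
apply: (@edge_sets_immersion _ e t (fun i => inl i)
         (fun i j => [set E in path_edges (inl i) (square_path i j)])).
- by move=> i j [].
- move=> i j /square_path_ok[pp <-]; apply/connectP; exists (square_path i j) => //.
  by rewrite path_via pp; apply/allP=> E Ep; rewrite /= inE.
move=> i j k l E ij kl; rewrite !inE => /(square_path_mark ij) H /(square_path_mark kl).
have fin : i = k :> nat -> j = l :> nat -> (i, j) = (k, l).
  by move=> /val_inj-> /val_inj->.
case: H => -[-> H] [] [] // _; [|by move: H => [? ?] [? ?]; apply: fin; congruence..].
rewrite H => E'; apply: pair_mem_lt => //.
  by have := set21 (inl i : 'I_t + 'I_4) (inl j); rewrite E' !inE.
by have := set22 (inl i : 'I_t + 'I_4) (inl j); rewrite E' !inE.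
Qed.

(** A leaf meets other edges only at its inner end, hence its neighbours form a clique. There are
    three of them at vertex 1; at 2 and at 0 there are [t - 2], all inner edges except the two sides
    missing that vertex. *)
Lemma leaf_simplicial (q : 'I_4) : #|nbrs e (inr q)| < n.+4 /\
  forall a b, e (inr q) a -> e (inr q) b -> a != b -> e a b.
Proof.
split; last first.
  have H a : e (inr q) a -> inc square_ends (square_ends (inr q)).1 a.
    by case: q a => [[|[|[|[|q]]]] Hq] [[[|[|[|[|k]]]] Hk]|[[|[|[|[|k]]]] Hk]].
  by move=> a b /H Ha /H Hb ne; apply/lineP; split=> //; exists (square_ends (inr q)).1.
have small (A : {set 'I_t + 'I_4}) : #|A| < n.+4 -> nbrs e (inr q) \subset A -> #|nbrs e (inr q)| < n.+4.
  by move=> A3 /subset_leq_card /leq_ltn_trans; apply.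
have big (x y : 'I_t) : x != y -> #|[set (inl k : 'I_t + 'I_4) | k in ~: [set x; y]]| < n.+4.
  move=> xy; rewrite card_imset => [|? ? []//].
  by rewrite cardsCs setCK cards2 xy card_ord.
case: q small => [[|[|[|[|q]]]] Hq] // small.
- apply: (small [set @rim 0 isT; @rim 1 isT; @leaf 1 isT]); first by rewrite -setUA cardsU1 cards2 !inE.
  by apply/subsetP=> -[[[|[|[|[|k]]]] Hk]|[[|[|[|[|k]]]] Hk]]; rewrite !inE.
- apply: (small [set @rim 0 isT; @rim 1 isT; @leaf 0 isT]); first by rewrite -setUA cardsU1 cards2 !inE.
  by apply/subsetP=> -[[[|[|[|[|k]]]] Hk]|[[|[|[|[|k]]]] Hk]]; rewrite !inE.
- apply: small (big (@Ordinal t 0 isT) (@Ordinal t 3 isT) isT) _.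
  apply/subsetP=> -[[[|[|[|[|k]]]] Hk]|[[|[|[|[|k]]]] Hk]]; rewrite !inE // => _;
    by apply: imset_f; rewrite !inE.
apply: small (big (@Ordinal t 1 isT) (@Ordinal t 2 isT) isT) _.
apply/subsetP=> -[[[|[|[|[|k]]]] Hk]|[[|[|[|[|k]]]] Hk]]; rewrite !inE // => _;
  by apply: imset_f; rewrite !inE.
Qed.

(** Once the four simplicial leaves are deleted, [t] branch sets share [t] vertices and are
    singletons, but opposite sides of the square are not adjacent. *)
Lemma square_no_minor : ~ has_Kt_minor e t.
Proof.
case=> B0 model0.
have del q (B : 'I_t -> {set 'I_t + 'I_4}) : minor_model e B -> minor_model e (fun i => B i :\ inr q).
  have [deg simp] := leaf_simplicial q.
  by apply: delete_simplicial => //; [apply: line_sym | apply: line_irr].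
have {model0} := del (@Ordinal 4 3 isT) _ (del (@Ordinal 4 2 isT) _
  (del (@Ordinal 4 1 isT) _ (del (@Ordinal 4 0 isT) _ model0))).
set B := (fun i => _) => -[Bne [Bdis [_ Badj]]].
have noleaf q i : inr q \notin B i by rewrite /B !inE; case: q => [[|[|[|[|k]]]] Hk].
have /fin_all_exists[y Hy] : forall i, exists y : 'I_t, inl y \in B i.
  move=> i; case/set0Pn: (Bne i) => -[y|q] yB; first by exists y.
  by rewrite (negPf (noleaf q i)) in yB.
have Buniq i j x : x \in B i -> x \in B j -> i = j.
  by move=> xi xj; apply/eqP; apply: contraT => /Bdis /disjointFr/(_ xi); rewrite xj.
have y_inj : injective y by move=> i j E; apply: (Buniq _ _ (inl (y i))); rewrite // E.
have [g gK Kg] := injF_bij y_inj.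
have By i x : x \in B i -> x = inl (y i).
  case: x => [x|q] xB; last by rewrite (negPf (noleaf q i)) in xB.
  by rewrite (Buniq _ _ _ xB (_ : _ \in B (g x))) ?Kg // -{1}(Kg x).
pose i := g (@Ordinal t 0 isT); pose j := g (@Ordinal t 2 isT).
have ij : i != j by rewrite (can_eq Kg).
by have [x [z [/By-> /By->]]] := Badj i j ij; rewrite !Kg.
Qed.

End Chorded4Cycle.

(** * A line graph with a minor but no immersion *)

Section CubicRows.

Variable n : nat.
Notation t := n.+2.
Notation node := ('I_t * 'I_t * option bool)%type.

Definition sorted_pair (i j : 'I_t) := if i <= j then (i, j) else (j, i).

(* Row [i] is a cycle through the nodes [(i, j)], each of its edges being subdivided; a path of
   length two through a common midpoint joins [(i, j)] to [(j, i)]. *)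
Definition row_ends (f : node) : node * node :=
  let: (i, j, k) := f in
  match k with
  | None => ((i, j, None), (i, j, Some false))
  | Some false => ((i, ordS j, None), (i, j, Some false))
  | Some true => ((i, j, None), (sorted_pair i j, Some true))
  end.

Notation e := (line_rel row_ends).

Lemma row_loopless f : (row_ends f).1 != (row_ends f).2.
Proof. by case: f => [[i j] [[|]|]] /=; apply/eqP=> -[]. Qed.

(** The first end of an edge is a node of a row and the second a subdividing vertex. The former has
    three edges, the latter at most two, which leaves at most [2 + 1] neighbours. *)
Lemma row_degree f : #|nbrs e f| <= 3.
Proof.
pose p := row_ends f.
have sub : nbrs e f \subset [set g | (g != f) && ((row_ends g).1 == p.1)]
                         :|: [set g | (g != f) && ((row_ends g).2 == p.2)].
  apply/subsetP=> g; rewrite !inE /line_rel /share_end eq_sym => /andP[-> /=].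
  rewrite (eq_sym (row_ends g).1) (eq_sym (row_ends g).2) -/p.
  have k1 h : isSome (row_ends h).1.2 = false by case: h => [[? ?] [[]|]].
  have k2 h : isSome (row_ends h).2.2 by case: h => [[? ?] [[]|]].
  case/or4P=> [->//|/eqP E|/eqP E|->]; rewrite ?orbT //.
    by have := k2 g; rewrite -E k1.
  by have := k2 f; rewrite E k1.
apply: leq_trans (subset_leq_card sub) _; apply: leq_trans (leq_card_setU _ _) _.
rewrite -[3]/(2 + 1); apply: leq_add.
  have s3 : [set g | (row_ends g).1 == p.1] \subset
      [set (p.1.1, None); (p.1.1, Some true); ((p.1.1.1, ord_pred p.1.1.2), Some false)].
    apply/subsetP=> -[[i j] [[]|]]; rewrite !inE => /eqP<- /=; rewrite ?eqxx ?orbT //.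
    by rewrite ordSK !eqxx !orbT.
  have c3 (x y z : node) : #|[set x; y; z]| <= 3.
    by apply: leq_trans (leq_card_setU _ _) _; rewrite cards1 cards2; case: eqP.
  have := leq_trans (subset_leq_card s3) (c3 _ _ _); rewrite (cardsD1 f) inE eqxx /=.
  have -> // : [set g | (row_ends g).1 == p.1] :\ f = [set g | (g != f) && ((row_ends g).1 == p.1)].
  by apply/setP=> g; rewrite !inE.
pose S2 := if p.2.2 == Some true then [set (p.2.1, Some true); ((p.2.1.2, p.2.1.1), Some true)]
           else [set (p.2.1, None); (p.2.1, Some false)].
have s2 : [set g | (row_ends g).2 == p.2] \subset S2.
  rewrite /S2; apply/subsetP=> -[[i j] [[]|]]; rewrite inE => /eqP<- /=; rewrite ?inE ?eqxx ?orbT //.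
  by rewrite /sorted_pair; case: ifP => _ /=; rewrite eqxx ?orbT.
have S2_le : #|S2| <= 2 by rewrite /S2; case: ifP => _; rewrite cards2; case: eqP.
have := leq_trans (subset_leq_card s2) S2_le; rewrite (cardsD1 f) inE eqxx /=.
have -> // : [set g | (row_ends g).2 == p.2] :\ f = [set g | (g != f) && ((row_ends g).2 == p.2)].
by apply/setP=> g; rewrite !inE.
Qed.

(** The rows are the branch sets; rows [i] and [j] touch at the midpoint between [(i, j)] and
    [(j, i)]. *)
Lemma row_minor : has_Kt_minor e t.
Proof.
pose B (i : 'I_t) := [set f : node | f.1.1 == i].
have step i j k j' k' z : inc row_ends z (i, j, k) -> inc row_ends z (i, j', k') ->
    connect (induced e (B i)) (i, j, k) (i, j', k').
  by apply: connect_share; rewrite inE.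
apply: (@minor_lt _ _ (line_sym row_ends) t B) => [i|i|i j ij].
- by apply/set0Pn; exists (i, i, None); rewrite inE.
- have row j (jt : j < t) : connect (induced e (B i)) (i, ord0, None) (i, Ordinal jt, None).
    elim: j jt => [|j IH] jt; first by rewrite (_ : ord0 = Ordinal jt) //; apply: val_inj.
    have jt' : j < t by apply: ltnW.
    apply: connect_trans (IH jt') _; have E : Ordinal jt = ordS (Ordinal jt').
      by apply: val_inj; rewrite /= modn_small.
    apply: (connect_trans (y := (i, Ordinal jt', Some false))).
      by apply: (step _ _ _ _ _ (i, Ordinal jt', Some false)); rewrite /inc /= eqxx orbT.
    by apply: (step _ _ _ _ _ (i, Ordinal jt, None)); rewrite /inc /= ?E eqxx.
  apply: (connected_root (line_sym row_ends) (r := (i, ord0, None))) => -[[i' j] k].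
  rewrite inE /= => /eqP->; case: j => j jt; apply: connect_trans (row j jt) _.
  case: k => [[]|]; last exact: connect0.
    by apply: (step _ _ _ _ _ (i, Ordinal jt, None)); rewrite /inc /= eqxx.
  by apply: (step _ _ _ _ _ (i, Ordinal jt, Some false)); rewrite /inc /= eqxx orbT.
have dis : [disjoint B i & B j].
  rewrite -setI_eq0; apply/eqP/setP=> f; rewrite !inE; apply/negP=> /andP[/eqP-> /eqP E].
  by rewrite E ltnn in ij.
split=> //; apply: (@touch _ _ row_ends _ _ (i, j, Some true)) => //.
  by exists (i, j, Some true); rewrite ?inE // /inc /= /sorted_pair (ltnW ij) eqxx orbT.
by exists (j, i, Some true); rewrite ?inE // /inc /= /sorted_pair leqNgt ij eqxx orbT.
Qed.


End CubicRows.

(** * Invariance under equal relations, and conclusion *)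

Lemma eq_immersion (V : finType) (e e' : rel V) t :
  e =2 e' -> has_Kt_immersion e t -> has_Kt_immersion e' t.
Proof.
move=> ee' [phi [phi_inj [P [Pp Pd]]]]; exists phi; split=> //; exists P; split=> // i j.
by rewrite -(eq_path ee'); apply: Pp.
Qed.

Lemma eq_minor (V : finType) (e e' : rel V) t : e =2 e' -> has_Kt_minor e t -> has_Kt_minor e' t.
Proof.
move=> ee' [B [B0 [Bd [Bc Ba]]]]; exists B; split=> //; split=> //; split=> [i x y xi yi|i j ij].
  rewrite (eq_connect (e' := induced e (B i))) ?Bc // => a b.
  by rewrite /induced ee'.
by have [x [y [xi yj exy]]] := Ba i j ij; exists x, y; rewrite -ee'.
Qed.

Theorem theorem1p4 :
  (forall (V : finType) (e : rel V) (t : nat),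
      is_line_graph e -> 0 < t <= 4 ->
      (has_Kt_immersion e t <-> has_Kt_minor e t)) /\
  (forall t : nat, 5 <= t ->
      (exists (V : finType) (e : rel V),
          [/\ is_line_graph e, has_Kt_immersion e t & ~ has_Kt_minor e t]) /\
      (exists (V : finType) (e : rel V),
          [/\ is_line_graph e, has_Kt_minor e t & ~ has_Kt_immersion e t])).
Proof.
split=> [V e t [W [E [ends0 [ne0 [h [h_bij eE]]]]]] /andP[t0 t4] | t t5].
  (* Pulling the ends back along the bijection makes [V] itself the edge set of [H]. *)
  pose ends x := ends0 (h x).
  have ne f : (ends f).1 != (ends f).2 by apply: ne0.
  have ee x y : e x y = line_rel ends x y.
    by rewrite eE /line_rel (inj_eq (bij_inj h_bij)).
  split=> [/(eq_immersion ee) I | /(eq_minor ee) M].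
    apply: (@eq_minor _ (line_rel ends)) => //.
    case: t t0 t4 I => [|[|[|[|[|t]]]]] // _ _.
    + exact: immersion_minor1 (line_sym ends).
    + exact: immersion_minor2 (line_sym ends) (line_irr ends).
    + exact: immersion_minor3 (line_sym ends) (line_irr ends).
    exact: immersion_minor4.
  apply: (@eq_immersion _ (line_rel ends)) => //.
  exact: (minor_immersion (line_sym ends) (line_irr ends) t4 M).
have [n ->] : exists n, t = n.+4.+1 by exists (t - 5); lia.
split.
  exists _, (line_rel (@square_ends n)); split.
  - exact/line_is_line/square_loopless.
  - exact: square_immersion.
  exact: square_no_minor.
(* The construction with parameter [n.+3] has [n.+4.+1] rows. An immersion would need a vertex of
   degree at least [n.+4], above the maximum degree 3. *)
exists _, (line_rel (@row_ends n.+3)); split; first exact/line_is_line/row_loopless.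
  exact: row_minor.
case/(immersion_degree (line_sym _)) => f.
by rewrite leqNgt (leq_trans _ (_ : 4 <= n.+4)) // ltnS row_degree.
Qed.
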